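(* Every direct sum $U_{r_1,n_1}\oplus U_{r_2,n_2}\oplus\cdots\oplus U_{r_k,n_k}$ of uniform matroids is extremal.
   Context: All matroids are finite. $U_{r,n}$ denotes the uniform matroid of rank $r$ on $n$ elements ($0\le r\le n$). Extremal matroids: a cyclic flat is a flat that is a union of circuits; a matroid is nested if its cyclic flats form a chain. For a matroid $M$ on $[n]$, $\mathcal{P}(M)\subseteq\mathbb{R}^n$ is the convex hull of the characteristic vectors of its bases. For $X\subseteq\mathbb{R}^n$, $\mathbb{I}(X)(x_1,\ldots,x_n)=\frac{1}{n!}\sum_{\sigma\in S_n}\bar{\mathbb{I}}(X)(x_{\sigma(1)},\ldots,x_{\sigma(n)})$ with $\bar{\mathbb{I}}(X)$ the indicator function. Up to isomorphism there are $\binom nr$ nested matroids of rank $r$ on $n$ elements; fix representatives $N_j$ on $[n]$. Each rank-$r$ matroid $M$ on $[n]$ has unique integers $c_j$ with $\mathbb{I}(\mathcal{P}(M))=\sum_j c_j\mathbb{I}(\mathcal{P}(N_j))$; the vector $(c_j)$ depends only on the isomorphism class of $M$. $\Omega_{r,n}$ is the convex hull of these vectors over all rank-$r$ matroids on $n$ elements; a matroid is extremal if its vector is a vertex of $\Omega_{r,n}$. *)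

(* Defs.v *)
From HB Require Import structures.
From mathcomp Require Import all_boot all_order all_fingroup all_algebra.
From mathcomp Require Import boolp classical_sets reals numfun.

Set Implicit Arguments.
Unset Strict Implicit.
Unset Printing Implicit Defensive.

Import Order.TTheory GRing.Theory Num.Theory.

Local Open Scope ring_scope.

Definition matroid_axiom (T : finType) (B : {set {set T}}) : bool :=
  (B != finset.set0) &&
  [forall X in B, forall Y in B, forall x in X :\: Y,
     exists y in Y :\: X, (y |: (X :\ x))%SET \in B].

Record matroid (T : finType) := Matroid {
  bases : {set {set T}};
  basesP : matroid_axiom bases
}.

HB.instance Definition _ (T : finType) := [isSub for @bases T].
HB.instance Definition _ (T : finType) := [Finite of matroid T by <:].

Definition isomorphic (T1 T2 : finType) (M1 : matroid T1) (M2 : matroid T2) :=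
  exists f : T1 -> T2, bijective f /\
    forall B : {set T1}, (B \in bases M1) = (f @: B \in bases M2).

Section Notions.
Variables (T : finType) (M : matroid T).

Definition indep (X : {set T}) : bool := [exists B in bases M, X \subset B].

Definition circuit (C : {set T}) : bool := minset [pred X | ~~ indep X] C.

Definition rk (X : {set T}) : nat := \max_(B in bases M) #|X :&: B|.

Definition rank : nat := rk [set: T].

Definition flat (F : {set T}) : bool :=
  [forall e, (e \notin F) ==> (rk F < rk (e |: F))%N].

Definition cyclic_flat (F : {set T}) : bool :=
  flat F &&
  [exists S : {set {set T}}, [forall C in S, circuit C] && (F == finset.cover S)].

Definition nested : bool :=
  [forall F : {set T}, forall G : {set T},
     cyclic_flat F && cyclic_flat G ==> (F \subset G) || (G \subset F)].

End Notions.

Lemma uniform_subproof (r n : nat) : (r <= n)%N ->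
  matroid_axiom [set B : {set 'I_n} | #|B| == r].
Proof.
move=> le_rn; apply/andP; split.
  apply/finset.set0Pn.
  have : (0 < #|[set B : {set 'I_n} | #|B| == r]|)%N.
    by rewrite card_draws card_ord bin_gt0.
  by case/card_gt0P=> B HB; exists B.
apply/forall_inP => X; rewrite inE => /eqP cX.
apply/forall_inP => Y; rewrite inE => /eqP cY.
apply/forall_inP => x; rewrite inE => /andP[xY xX].
have: (0 < #|Y :\: X|)%N.
  have e : (#|Y :\: X| = #|X :\: Y|)%N by rewrite !cardsD finset.setIC cX cY.
  by rewrite e; apply/card_gt0P; exists x; rewrite inE xY.
case/card_gt0P => y yYX; apply/exists_inP; exists y => //.
move: yYX; rewrite inE => /andP[yX _].
rewrite inE cardsU1 !inE negb_and yX orbT -cX.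
by rewrite (cardsD1 x X) xX.
Qed.

Definition uniform (r n : nat) (le_rn : (r <= n)%N) : matroid 'I_n :=
  Matroid (uniform_subproof le_rn).

Section DirectSum.
Variables (I : finType) (T : I -> finType) (M : forall i, matroid (T i)).

Definition part (B : {set {i : I & T i}}) (i : I) : {set T i} :=
  [set x | Tagged T x \in B].

Lemma dsum_subproof :
  matroid_axiom [set B | [forall i, part B i \in bases (M i)]].
Proof.
apply/andP; split.
  have HB i : exists B, B \in bases (M i).
    by case/andP: (basesP (M i)) => /finset.set0Pn.
  pose F i := xchoose (HB i).
  apply/finset.set0Pn; exists [set u | tagged u \in F (tag u)].
  rewrite inE; apply/forallP => i.
  have -> : part [set u | tagged u \in F (tag u)] i = F i.
    by apply/finset.setP => x; rewrite !inE.
  exact: xchooseP.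
apply/forall_inP => X; rewrite inE => /forallP HX.
apply/forall_inP => Y; rewrite inE => /forallP HY.
apply/forall_inP => -[i x]; rewrite inE => /andP[xY xX].
case/andP: (basesP (M i)) => _ /forall_inP/(_ _ (HX i)).
move/forall_inP/(_ _ (HY i)); move/forall_inP/(_ x).
have xD : x \in part X i :\: part Y i by rewrite !inE xY.
case/(_ xD)/exists_inP => y; rewrite !inE => /andP[yX yY] Hy.
apply/exists_inP; exists (Tagged T y); first by rewrite !inE yX.
rewrite inE; apply/forallP => j.
have [eji|neji] := eqVneq j i.
  rewrite {}eji.
  suff -> : part (Tagged T y |: (X :\ Tagged T x))%SET i =
            (y |: (part X i :\ x))%SET by [].
  by apply/finset.setP => z; rewrite !inE !eq_Tagged.
suff -> : part (Tagged T y |: (X :\ Tagged T x))%SET j = part X j by [].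
apply/finset.setP => z; rewrite !inE -!tag_eqE /tag_eq /=.
by rewrite (negbTE neji).
Qed.

Definition dsum : matroid {i : I & T i} := Matroid dsum_subproof.

End DirectSum.

Section Geometry.
Variable R : realType.

Definition conv_hull (d : nat) (A : set 'rV[R]_d) : set 'rV[R]_d :=
  [set x | exists (p : nat) (w : 'I_p -> R) (v : 'I_p -> 'rV[R]_d),
     [/\ forall i, 0 <= w i, \sum_i w i = 1, forall i, A (v i)
       & x = \sum_i w i *: v i]]%classic.

(* A vertex is a face of dimension 0: a point at which some linear functional
   attains its maximum over P, and attains it nowhere else on P. *)
Definition vertex (d : nat) (P : set 'rV[R]_d) (v : 'rV[R]_d) : Prop :=
  P v /\ exists a : 'I_d -> R,
    forall x, P x -> x <> v -> \sum_j a j * x 0 j < \sum_j a j * v 0 j.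

Variable n : nat.

Definition char_vec (B : {set 'I_n}) : 'rV[R]_n := \row_i (i \in B)%:R.

Definition base_polytope (M : matroid 'I_n) : set 'rV[R]_n :=
  conv_hull [set x | exists2 B, B \in bases M & x = char_vec B]%classic.

(* [col_perm s x] is the vector (x_{s(1)}, ..., x_{s(n)}). *)
Definition sym_indic (X : set 'rV[R]_n) (x : 'rV[R]_n) : R :=
  (n`!%:R)^-1 * \sum_(s : 'S_n) \1_X (col_perm s x).

Variables (m : nat) (N : 'I_m -> matroid 'I_n).

(* [c] is the vector of integers with I(P(M)) = \sum_j c_j I(P(N_j)); it is
   unique when [N] is a system of representatives as in [nested_reps]. *)
Definition coef_vec (M : matroid 'I_n) (c : 'rV[int]_m) : Prop :=
  forall x, sym_indic (base_polytope M) x =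
            \sum_j (c 0 j)%:~R * sym_indic (base_polytope (N j)) x.

Definition Omega (r : nat) : set 'rV[R]_m :=
  conv_hull [set v | exists M c,
    [/\ rank M = r, coef_vec M c & v = map_mx intr c]]%classic.

Definition extremal (M : matroid 'I_n) : Prop :=
  exists2 c, coef_vec M c & vertex (Omega (rank M)) (map_mx intr c).

End Geometry.

(* N lists each isomorphism class of nested matroids of rank r on [n] exactly
   once (this forces m = 'C(n, r)). *)
Definition nested_reps (n r m : nat) (N : 'I_m -> matroid 'I_n) : Prop :=
  [/\ forall j, nested (N j) /\ rank (N j) = r,
      forall M : matroid 'I_n, nested M -> rank M = r ->
        exists j, isomorphic M (N j)
    & forall i j, isomorphic (N i) (N j) -> i = j].

Lemma isomorphic_refl (T : finType) (M : matroid T) : isomorphic M M.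
Proof.
by exists id; split=> [|B]; [exists id | rewrite finset.imset_id].
Qed.

Lemma isomorphic_sym (T1 T2 : finType) (M1 : matroid T1) (M2 : matroid T2) :
  isomorphic M1 M2 -> isomorphic M2 M1.
Proof.
case=> f [[g fK gK] H]; exists g; split=> [|B]; first by exists f.
by rewrite H -finset.imset_comp (finset.eq_imset (g := id)) ?finset.imset_id.
Qed.

Lemma isomorphic_trans (T1 T2 T3 : finType) (M1 : matroid T1)
    (M2 : matroid T2) (M3 : matroid T3) :
  isomorphic M1 M2 -> isomorphic M2 M3 -> isomorphic M1 M3.
Proof.
case=> f [bf Hf] [g [bg Hg]]; exists (g \o f); split=> [|B].
  exact: bij_comp.
by rewrite Hf Hg -finset.imset_comp.
Qed.

Lemma nested_reps_exist (n r : nat) :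
  exists (m : nat) (N : 'I_m -> matroid 'I_n), nested_reps r N.
Proof.
pose P (M : matroid 'I_n) := nested M && (rank M == r).
pose Q (M M' : matroid 'I_n) := P M' && `[< isomorphic M M' >].
pose canon M := choose (Q M) M.
have QM M : P M -> Q M M.
  by move=> PM; rewrite /Q PM; apply/asboolP; exact: isomorphic_refl.
have Qc M : P M -> Q M (canon M) by move=> PM; exact: chooseP (QM M PM).
have canonE M M' : P M -> P M' -> isomorphic M M' -> canon M = canon M'.
  move=> PM PM' MM'; rewrite /canon.
  have E : Q M =1 Q M'.
    move=> X; rewrite /Q; congr (_ && _); apply/asboolP/asboolP => h.
      exact: isomorphic_trans (isomorphic_sym MM') h.
    exact: isomorphic_trans MM' h.
  by rewrite (eq_choose E); apply: choose_id; rewrite ?QM -?E ?QM.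
pose s := undup [seq canon M | M <- enum P].
exists (size s), (fun j => tnth (in_tuple s) j).
have sP (j : 'I_(size s)) : exists2 M, P M & tnth (in_tuple s) j = canon M.
  have := mem_tnth j (in_tuple s).
  rewrite mem_undup => /mapP[M]; rewrite mem_enum => PM ->.
  by exists M.
split=> [j | M nM rM | i j].
- by have [M /Qc/andP[/andP[nM /eqP rM] _] ->] := sP j.
- have PM : P M by rewrite /P nM rM eqxx.
  have cs : canon M \in s.
    by rewrite mem_undup map_f // mem_enum.
  have /tnthP[j Ej] : canon M \in in_tuple s by [].
  exists j; rewrite -Ej.
  by have /andP[_ /asboolP] := Qc M PM.
- have [M PM Ei] := sP i; have [M' PM' Ej] := sP j.
  rewrite Ei Ej => h.
  have /andP[_ /asboolP h1] := Qc M PM.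
  have /andP[_ /asboolP h2] := Qc M' PM'.
  have E := canonE _ _ PM PM'
    (isomorphic_trans h1 (isomorphic_trans h (isomorphic_sym h2))).
  have : tnth (in_tuple s) i = tnth (in_tuple s) j by rewrite Ei Ej.
  apply/tuple_uniqP; exact: undup_uniq.
Qed.

(* Main.v *)
Require Import Defs.
From mathcomp Require Import all_boot all_order all_fingroup all_algebra.
From mathcomp Require Import zify ring lra.

(* Let [M] be the direct sum of the [U_(r_i, n_i)] on blocks [E_i].

   Extremality.  [P(M)] is the slice of the cube by the hyperplanes
   [x(E_i) = r_i], so if a base polytope [P(M')] is covered by the relabelings
   of [P(M)], then by convexity it lies in one of them and [M'] has at most as
   many bases as [M], with equality only for relabelings of [M].  If it is not
   covered, pick a point [y_M'] of [P(M')] outside all of them.  Evaluating the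
   symmetrized indicator function at a vertex of [P(M)] counts bases, and
   subtracting a large multiple of its values at the finitely many [y_M'] gives
   a linear functional that is maximal exactly at the class of [M].

   Existence of the coefficients.  Put [y_i = x(E_i) - r_i].  The alternating
   sum over the chains [C] of proper nonempty subsets of the set of blocks, all
   of whose members [S] satisfy [y(S) <= 0], is [+-1] if [y = 0] and [0]
   otherwise.  For fixed [C] these inequalities cut out the base polytope of a
   nested matroid.

   Uniqueness.  The symmetrized indicator functions of nonisomorphic nested
   matroids are linearly independent: whether the maximum of a linear form on
   a polytope has a given value is a valuation (Euler characteristic), and for
   a suitable form depending on the nested matroid [N] it is nonzero only at
   matroids all of whose bases are bases of [N]. *)

Set Implicit Arguments.
Unset Strict Implicit.
Unset Printing Implicit Defensive.

Import Order.TTheory GRing.Theory Num.Theory.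

(** * Matroids *)

Definition is_chain (T : finType) (FF : {set {set T}}) : Prop :=
  forall F G, F \in FF -> G \in FF -> (F \subset G) || (G \subset F).

Section MatroidTheory.
Variables (T : finType) (M : matroid T).
Implicit Types (B C D F G I X Y : {set T}).

Lemma exists_basis : exists B, B \in bases M.
Proof. by case/andP: (basesP M) => /set0Pn. Qed.

Lemma basis_exchange B B' x : B \in bases M -> B' \in bases M ->
  x \in B -> x \notin B' ->
  exists y, [/\ y \in B', y \notin B & y |: B :\ x \in bases M].
Proof.
move=> BM B'M xB xB'.
case/andP: (basesP M) => _ /forall_inP/(_ B BM)/forall_inP/(_ B' B'M).
move/forall_inP/(_ x); rewrite inE xB xB' => /(_ isT)/exists_inP[y].
by rewrite inE => /andP[yB yB'] yM; exists y.
Qed.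

Lemma card_exchange B x y : x \in B -> y \notin B -> #|y |: B :\ x| = #|B|.
Proof.
move=> xB yB; rewrite cardsU1 !inE negb_and yB orbT.
by rewrite [in RHS](cardsD1 x) xB.
Qed.

Lemma card_exchangeD B B' x y : x \in B -> x \notin B' -> y \in B' ->
  #|(y |: B :\ x) :\: B'| < #|B :\: B'|.
Proof.
move=> xB xB' yB'; apply: proper_card; apply/properP; split.
  apply/subsetP => z; rewrite !inE => /andP[zB' /orP[/eqP zy|/andP[_ ->]]].
    by rewrite zy yB' in zB'.
  by rewrite zB'.
exists x; first by rewrite inE xB xB'.
rewrite !inE xB' eqxx /= orbF.
by apply: contraNN xB' => /eqP->.
Qed.

(** Exchanges bring [B] closer to [B'] without changing its size, until it lies inside [B']. *)
Lemma card_basis_le B B' : B \in bases M -> B' \in bases M -> #|B| <= #|B'|.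
Proof.
move=> BM B'M; have [k] := ubnP #|B :\: B'|.
elim: k B BM => // k IHk B BM; rewrite ltnS => lek.
have [|[x]] := set_0Vmem (B :\: B').
  by move/eqP; rewrite setD_eq0 => /subset_leq_card.
rewrite inE => /andP[xB' xB].
have [y [yB' yB yM]] := basis_exchange BM B'M xB xB'.
rewrite -(card_exchange xB yB); apply: IHk => //.
exact: leq_trans (card_exchangeD xB xB' yB') lek.
Qed.

Lemma rk_ge B X : B \in bases M -> #|X :&: B| <= rk M X.
Proof. by move=> BM; rewrite /rk (bigD1 B) //= leq_maxl. Qed.

Lemma rk_attained X : exists2 B, B \in bases M & rk M X = #|X :&: B|.
Proof.
have [B0 B0M] := exists_basis.
have c0 : 0 < #|[pred B | B \in bases M]| by apply/card_gt0P; exists B0.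
by have [B BM e] := eq_bigmax_cond (fun B => #|X :&: B|) c0; exists B.
Qed.

Lemma rank_basis B : B \in bases M -> rank M = #|B|.
Proof.
move=> BM; rewrite /rank; have [B' B'M ->] := rk_attained [set: T].
by rewrite setTI; apply/eqP; rewrite eqn_leq !card_basis_le.
Qed.

Lemma rkS X Y : X \subset Y -> rk M X <= rk M Y.
Proof.
move=> XY; have [B BM ->] := rk_attained X.
by apply: leq_trans (rk_ge Y BM); apply/subset_leq_card/setSI.
Qed.

Lemma indepE X : indep M X = (#|X| <= rk M X).
Proof.
apply/exists_inP/idP => [[B BM XB]|].
  by rewrite -{1}(setIidPl XB) rk_ge.
have [B BM ->] := rk_attained X => le.
exists B => //; apply/setIidPl/eqP.
by rewrite eqEcard subsetIl.
Qed.

Lemma indepS X Y : X \subset Y -> indep M Y -> indep M X.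
Proof.
move=> XY /exists_inP[B BM YB]; apply/exists_inP; exists B => //.
exact: subset_trans XY YB.
Qed.

(** Elements of [B'] outside [F] and [B] can be exchanged away without shrinking [F :&: B']. Once
    [B' :\: B] lies in [F], counting gives a [y] in [B] outside [F] and [B'], and whatever replaces
    it in [B] comes from [F]. *)
Lemma basis_exchange_into F B B' : B \in bases M -> B' \in bases M ->
  #|F :&: B| < #|F :&: B'| ->
  exists x y, [/\ x \in F, x \notin B, y \in B, y \notin F &
                  x |: B :\ y \in bases M].
Proof.
move=> BM; have [k] := ubnP #|B' :\: B|.
elim: k B' => // k IHk B'; rewrite ltnS => lek B'M ltB.
have [sub|] := boolP (B' :\: B \subset F); last first.
  case/subsetPn => x; rewrite inE => /andP[xB xB'] xF.
  have [y [yB yB' yM]] := basis_exchange B'M BM xB' xB.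
  apply: (IHk (y |: B' :\ x)) => //.
    exact: leq_trans (card_exchangeD xB' xB yB) lek.
  apply: leq_trans ltB _; apply/subset_leq_card/subsetP => z.
  rewrite !inE => /andP[zF zB']; rewrite zF zB' /= andbT.
  by apply/orP; right; apply: contraTN zF => /eqP->.
have [subD|] := boolP (B :\: F \subset B').
  have : #|B :\: F| <= #|B' :\: F|.
    apply/subset_leq_card/subsetP => z zBF.
    by rewrite inE (subsetP subD z zBF) andbT; move: zBF; rewrite inE => /andP[].
  have := card_basis_le BM B'M; have := card_basis_le B'M BM.
  rewrite -(cardsID F B) -(cardsID F B') ![_ :&: F]setIC; lia.
case/subsetPn => y; rewrite inE => /andP[yF yB] yB'.
have [x [xB' xB xM]] := basis_exchange BM B'M yB yB'.
by exists x, y; split => //; apply: (subsetP sub); rewrite inE xB.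
Qed.

(* A basis maximizing the sum of the [#|F :&: B|] maximizes each of them. *)
Lemma chain_basis (FF : {set {set T}}) : is_chain FF ->
  exists2 B, B \in bases M & forall F, F \in FF -> #|F :&: B| = rk M F.
Proof.
move=> chFF; have [B0 B0M] := exists_basis.
case: (@arg_maxnP _ B0 (fun B => B \in bases M)
         (fun B => \sum_(F in FF) #|F :&: B|)) => // B BM maxB.
exists B => // F FFF; apply/eqP; rewrite eqn_leq rk_ge //= leqNgt.
have [B' B'M ->] := rk_attained F.
apply/negP => /(basis_exchange_into BM B'M)[x [y [xF xB yB yF xM]]].
have := maxB _ xM; rewrite /geq /= leqNgt => /negP; apply.
(* The exchange loses nothing on the rest of the chain: a larger [G] also gains [x], a smaller one
   does not contain [y]. *)
have incr G : G \in FF -> #|G :&: B| + (G == F) <= #|G :&: (x |: B :\ y)|.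
  move=> GFF; have [->|GF] := eqVneq G F.
    have -> : F :&: (x |: B :\ y) = x |: (F :&: B).
      apply/setP => z; rewrite !inE.
      have [->|_] := eqVneq z x; first by rewrite xF.
      by have [->|//] := eqVneq z y; rewrite (negbTE yF).
    by rewrite cardsU1 !inE xF xB addnC.
  rewrite addn0; have /orP[FG|sGF] := chFF _ _ FFF GFF.
    have xG := subsetP FG x xF.
    have xGB : x \notin (G :&: B) :\ y by rewrite !inE (negbTE xB) !andbF.
    apply: (@leq_trans #|x |: (G :&: B) :\ y|).
      by rewrite cardsU1 xGB (cardsD1 y (G :&: B)); case: (y \in _).
    apply/subset_leq_card/subsetP => z; rewrite !inE.
    by case/orP=> [/eqP->|/and3P[-> -> ->]]; rewrite ?xG ?eqxx ?orbT.
  apply/subset_leq_card/subsetP => z; rewrite !inE => /andP[zG ->].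
  rewrite zG andbT; apply/orP; right; apply: contraNneq yF => <-.
  exact: (subsetP sGF).
rewrite (bigD1 F) //= [X in _ < X](bigD1 F) //=.
have := incr F FFF; rewrite eqxx => h1.
rewrite -addSn; apply: leq_add; first by rewrite -addn1.
by apply: leq_sum => G /andP[GFF _]; apply: leq_trans (incr G GFF); apply: leq_addr.
Qed.

(** If [e] were outside [F], a basis that is maximal on [I], [F] and [e |: F] at once would contain
    [I], and also [e] because the rank rises. *)
Lemma flat_mem F I e : flat M F -> I \subset F -> indep M I ->
  ~~ indep M (e |: I) -> e \in F.
Proof.
move=> flF IF iI dI; apply: contraNT dI => eF.
have eFF : F \subset e |: F by rewrite subsetUr.
have IeF := subset_trans IF eFF.
have [B BM hB] : exists2 B, B \in bases M &
    forall G, G \in [set I; F; e |: F] -> #|G :&: B| = rk M G.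
  apply: chain_basis => G H; rewrite !inE.
  by do 2![case/orP=> [/orP[]|] /eqP->]; rewrite ?subxx ?IF ?eFF ?IeF ?orbT.
have IB : I \subset B.
  apply/setIidPl/eqP; rewrite eqEcard subsetIl hB -?indepE //.
  by rewrite !inE eqxx.
have /forallP/(_ e)/implyP/(_ eF) := flF.
rewrite -!hB ?inE ?eqxx ?orbT // => ltF.
apply/exists_inP; exists B => //; rewrite subUset IB andbT sub1set.
apply: contraLR ltF => eB; rewrite -leqNgt; apply/subset_leq_card/subsetP => z.
rewrite !inE => /andP[/orP[/eqP->|->] //].
by rewrite (negbTE eB).
Qed.

Lemma circuit_sub X : ~~ indep M X -> exists2 C, circuit M C & C \subset X.
Proof.
by move=> dX; have [C] := minset_exists (P := [pred X | ~~ indep M X]) dX; exists C.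
Qed.

Lemma circuit_dep C : circuit M C -> ~~ indep M C.
Proof. by case/minsetP. Qed.

Lemma circuitD1 C x : circuit M C -> x \in C -> indep M (C :\ x).
Proof.
move=> /minsetP[_ minC] xC; apply: contraT => d.
have /setP/(_ x) := minC (C :\ x) d (subD1set _ _).
by rewrite !inE eqxx xC.
Qed.

(* The cyclic flat is the closure of [C]. *)
Lemma circuit_cyclic_flat C : circuit M C ->
  exists F, [/\ cyclic_flat M F, C \subset F & rk M F < #|C|].
Proof.
move=> cC; have dC := circuit_dep cC.
have PC : (C \subset C) && (rk M C < #|C|).
  by rewrite subxx ltnNge -indepE.
have [F /maxsetP[/andP[CF rkF] maxF] _] :=
  maxset_exists (P := fun F => (C \subset F) && (rk M F < #|C|)) PC.
exists F; split=> //; apply/andP; split.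
  apply/forallP => e; apply/implyP => eF.
  have [//|le] := ltnP.
  have eFP : (C \subset e |: F) && (rk M (e |: F) < #|C|).
    rewrite (leq_ltn_trans le rkF) andbT.
    exact: subset_trans CF (subsetUr _ _).
  by move: eF; rewrite -(maxF _ eFP (subsetUr _ _)) setU11.
apply/existsP; exists [set D | circuit M D & D \subset F].
apply/andP; split; first by apply/forall_inP => D; rewrite inE => /andP[].
rewrite eqEsubset; apply/andP; split; last first.
  by apply/bigcupsP => D; rewrite inE => /andP[].
apply/subsetP => e eF.
have [eC|eC] := boolP (e \in C).
  by apply/bigcupP; exists C => //; rewrite inE cC CF.
have [f fC] : exists f, f \in C.
  by apply/set0Pn; rewrite -card_gt0; apply: leq_ltn_trans rkF.
(* The set [e |: C :\ f] is too large for the rank of [F], so it contains a circuit. This circuit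
   passes through [e], since [C :\ f] is independent. *)
have iD := circuitD1 cC fC.
have cardD : #|e |: C :\ f| = #|C| by exact: card_exchange.
have DF : e |: C :\ f \subset F.
  by rewrite subUset sub1set eF (subset_trans (subD1set _ _) CF).
have dD : ~~ indep M (e |: C :\ f).
  by rewrite indepE cardD -ltnNge (leq_ltn_trans (rkS DF)).
have [D cD DD] := circuit_sub dD.
apply/bigcupP; exists D; first by rewrite inE cD (subset_trans DD DF).
apply: contraT => eD; case/negP: (circuit_dep cD); apply: indepS iD.
apply/subsetP => z zD; have := subsetP DD z zD; rewrite inE in_set1.
by case/orP=> // /eqP ze; rewrite -ze zD in eD.
Qed.

(** A dependent [B] contains a circuit, and some cyclic flat around that circuit has rank below its
    size, which violates the bound. *)
Lemma basis_of_cyclic_flats B : #|B| = rank M ->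
  (forall F, cyclic_flat M F -> #|F :&: B| <= rk M F) -> B \in bases M.
Proof.
move=> cB hB; have [/exists_inP[B' B'M BB']|] := boolP (indep M B).
  suff -> : B = B' by [].
  by apply/eqP; rewrite eqEcard BB' cB (rank_basis B'M) leqnn.
case/circuit_sub => C cC CB; have [F [cF CF]] := circuit_cyclic_flat cC.
rewrite ltnNge => /negP[]; apply: leq_trans (hB F cF).
by apply/subset_leq_card; rewrite subsetI CF.
Qed.

(** The freedom preorder. Cyclic flats are closed under passing to less free elements, so they form
    a chain as soon as it is total. *)
Definition freer (a b : T) :=
  forall B, B \in bases M -> b \in B -> a \notin B -> a |: B :\ b \in bases M.

(** Take a circuit [C] of [F] through [a] and suppose that it avoids [b]. A basis containing
    [b |: C :\ a] would, after replacing [b] by [a] if necessary, contain [C]. So that set is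
    dependent and the flat contains [b]. *)
Lemma cyclic_flat_freer F a b :
  freer a b -> cyclic_flat M F -> a \in F -> b \in F.
Proof.
move=> fab /andP[flF /existsP[S /andP[/forall_inP cS /eqP FS]]] aF.
have : a \in cover S by rewrite -FS.
case/bigcupP=> C CS aC; have cC := cS C CS.
have CF : C \subset F by rewrite FS; apply: (bigcup_max C).
have [bC|bC] := boolP (b \in C); first exact: (subsetP CF).
apply: (flat_mem flF _ (circuitD1 cC aC)).
  exact: subset_trans (subD1set _ _) CF.
apply: contra (circuit_dep cC) => /exists_inP[B BM].
rewrite subUset sub1set => /andP[bB CB].
have [aB|aB] := boolP (a \in B).
  apply/exists_inP; exists B => //; apply/subsetP => z zC.
  by have [->//|za] := eqVneq z a; apply: (subsetP CB); rewrite !inE za.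
apply/exists_inP; exists (a |: B :\ b); first exact: fab.
apply/subsetP => z zC; rewrite !inE.
have [//|za] := eqVneq z a; rewrite (subsetP CB) ?inE ?za // andbT.
by apply: contraNneq bC => <-.
Qed.

Lemma nested_of_freer : (forall a b, freer a b \/ freer b a) -> nested M.
Proof.
move=> tot; apply/forallP => F; apply/forallP => G; apply/implyP.
case/andP=> cF cG; apply: contraT; rewrite negb_or.
case/andP=> /subsetPn[a aF aG] /subsetPn[b bG bF].
have [f|f] := tot a b.
  by rewrite (cyclic_flat_freer f cF aF) in bF.
by rewrite (cyclic_flat_freer f cG bG) in aG.
Qed.

Lemma nested_chain : nested M -> is_chain [set F | cyclic_flat M F].
Proof.
move=> /forallP nM F G; rewrite !inE => cF cG.
by have /forallP/(_ G) := nM F; rewrite cF cG.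
Qed.

End MatroidTheory.

(** * Nested matroids given by rank bounds on a chain of sets *)

Section ChainMatroid.
Variables (T : finType) (FF : {set {set T}}) (rho : {set T} -> nat) (r : nat).
Hypothesis chFF : is_chain FF.

Definition chain_bases : {set {set T}} :=
  [set B : {set T} | (#|B| == r) && [forall F in FF, #|F :&: B| <= rho F]].

Lemma chain_basesP (B : {set T}) :
  reflect (#|B| = r /\ forall F, F \in FF -> #|F :&: B| <= rho F)
          (B \in chain_bases).
Proof.
rewrite inE; apply: (iffP andP) => [[/eqP-> /forall_inP h]//|[-> h]].
by rewrite eqxx; split=> //; apply/forall_inP.
Qed.

Hypothesis chain_bases_n0 : chain_bases != set0.

(** When [y] replaces [x], sets containing [x] gain nothing and sets with slack can afford one more
    element. Only tight sets avoiding [x] forbid [y], and these all lie in one set [G]. *)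
Lemma chain_matroid_subproof : matroid_axiom chain_bases.
Proof.
apply/andP; split=> //.
apply/forall_inP => X /chain_basesP[cX hX].
apply/forall_inP => Y /chain_basesP[cY hY].
apply/forall_inP => x; rewrite inE => /andP[xY xX].
(* [G] is the largest tight set avoiding [x]. *)
pose tight F := [&& F \in FF, x \notin F & rho F == #|F :&: X|].
have [G [xG cG maxG]] : exists G : {set T}, [/\ x \notin G, #|G :&: Y| <= #|G :&: X| &
    forall F, tight F -> F \subset G].
  have [F0 tF0|no] := pickP tight; last first.
    exists set0; split=> [||F tF]; rewrite ?inE ?set0I ?cards0 //.
    by rewrite no in tF.
  case: (@arg_maxnP _ F0 tight (fun F => #|F|) tF0) => G tG maxG.
  have /and3P[GFF xG /eqP cG] := tG.
  exists G; split=> // [|F tF]; first by rewrite -cG hY.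
  have /and3P[FFF _ _] := tF.
  have /orP[//|GF] := chFF FFF GFF.
  suff -> : F = G by [].
  by apply/esym/eqP; rewrite eqEcard GF; exact: maxG.
(* Outside [G], [Y] has at least as many elements as [X], and [X] has the element [x] that [Y]
   lacks. *)
have [y yY yXG] : exists2 y, y \in Y :\: G & y \notin X.
  apply/subsetPn; apply: contraL (leqnn #|Y :\: G|) => sub; rewrite -ltnNge.
  apply: (@leq_trans #|X :\: G|).
    apply: proper_card; apply/properP; split.
      apply/subsetP => z zYG; rewrite inE (subsetP sub) // andbT.
      by move: zYG; rewrite inE => /andP[].
    by exists x; rewrite inE ?xG ?xX // (negbTE xY) andbF.
  move: cX; rewrite -cY -(cardsID G X) -(cardsID G Y) ![_ :&: G]setIC; lia.
move: yY; rewrite inE => /andP[yG yY].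
apply/exists_inP; exists y; first by rewrite inE yXG yY.
apply/chain_basesP; split; first by rewrite card_exchange.
move=> F FFF; have [yF|yF] := boolP (y \in F); last first.
  apply: leq_trans (hX F FFF); apply/subset_leq_card/subsetP => z.
  rewrite !inE => /andP[zF]; rewrite zF.
  by case/orP=> [/eqP zy|/andP[_ ->]//]; rewrite -zy zF in yF.
have [xF|xF] := boolP (x \in F).
  apply: leq_trans (hX F FFF).
  have -> : F :&: (y |: X :\ x) = y |: (F :&: X) :\ x.
    apply/setP => z; rewrite !inE.
    by have [->|] := eqVneq z y; rewrite ?yF //= andbCA.
  by rewrite card_exchange // !inE ?xF // (negbTE yXG) andbF.
apply: (@leq_trans #|F :&: X|.+1).
  rewrite -add1n -(cards1 y); apply: leq_trans (leq_card_setU _ _).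
  apply/subset_leq_card/subsetP => z; rewrite !inE.
  by case/andP=> -> /orP[->//|/andP[_ ->]]; rewrite orbT.
rewrite ltn_neqAle hX // andbT; apply: contra yG => /eqP e.
by apply: (subsetP (maxG F _)) yF; rewrite /tight FFF xF e eqxx.
Qed.

Definition chain_matroid := Matroid chain_matroid_subproof.

(** An element [a] is freer than [b] when every member of the chain containing [a] contains [b];
    along a chain any two elements compare. *)
Lemma chain_matroid_nested : nested chain_matroid.
Proof.
have frE a b : (forall F, F \in FF -> a \in F -> b \in F) ->
    freer chain_matroid a b.
  move=> ab B /chain_basesP[cB hB] bB aB; apply/chain_basesP.
  split=> [|F FFF]; first by rewrite card_exchange.
  have [aF|aF] := boolP (a \in F).
    apply: leq_trans (hB F FFF); have bF := ab F FFF aF.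
    have -> : F :&: (a |: B :\ b) = a |: (F :&: B) :\ b.
      apply/setP => z; rewrite !inE.
      by have [->|] := eqVneq z a; rewrite ?aF //= andbCA.
    by rewrite card_exchange // !inE ?bF // (negbTE aB) andbF.
  apply: leq_trans (hB F FFF); apply/subset_leq_card/subsetP => z.
  rewrite !inE => /andP[zF]; rewrite zF.
  by case/orP=> [/eqP za|/andP[_ ->]//]; rewrite -za zF in aF.
apply: nested_of_freer => a b.
have [/forall_inP h|] := boolP [forall F in FF, (a \in F) ==> (b \in F)].
  by left; apply: frE => F FFF; apply/implyP; apply: h.
rewrite negb_forall_in => /exists_inP[F FFF]; rewrite negb_imply => /andP[aF bF].
right; apply: frE => G GFF bG.
have /orP[FG|GF] := chFF FFF GFF; first exact: (subsetP FG).
by rewrite (subsetP GF) in bF.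
Qed.

End ChainMatroid.

(** * Alternating sums over chains *)

Section AlternatingChains.
Local Open Scope ring_scope.
Variable T : finType.
Implicit Types (A C : {set {set T}}) (S D : {set T}).

Definition chains_in A : {set {set {set T}}} :=
  [set C in powerset A | [forall F in C, forall G in C, (F \subset G) || (G \subset F)]].

Lemma chains_inP A C : reflect (C \subset A /\ is_chain C) (C \in chains_in A).
Proof.
rewrite !inE; apply: (iffP andP) => -[CA h]; split=> //.
  by move=> F G FC GC; exact: (forall_inP (forall_inP h F FC) G GC).
by apply/forall_inP => F FC; apply/forall_inP => G GC; exact: h.
Qed.

(** Up to sign, the reduced Euler characteristic of the order complex of [A]; the empty chain
    counts. *)
Definition alt_chains A : int := \sum_(C in chains_in A) (-1) ^+ #|C|.

Section Toggle.
Variables (A : {set {set T}}) (i : T).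
Hypothesis A1 : [set i] \in A.
Hypothesis Acone : forall S, S \in A -> i |: S \in A.

(** For a chain [C] this adds [i] to the largest member avoiding [i], or is [[set i]] if there is
    none. It is comparable to every member of [C], and inserting or deleting it does not change it,
    so [toggle] is an involution. *)
Let top C := i |: \bigcup_(S in C | i \notin S) S.

Let toggle C := if top C \in C then C :\ top C else top C |: C.

Let top_toggle C : top (toggle C) = top C.
Proof.
rewrite /top; congr (_ |: _); apply: eq_bigl => S; rewrite /toggle.
have [->|ne] := eqVneq S (top C); first by rewrite setU11 !andbF.
by case: ifP => _; rewrite !inE ?ne ?(negbTE ne).
Qed.

Let toggleK : involutive toggle.
Proof.
move=> C; rewrite {1}/toggle top_toggle /toggle.
have [tC|tC] := boolP (top C \in C); first by rewrite setD11 setD1K.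
by rewrite setU11 setU1K.
Qed.

Let chain_toggle C : C \in chains_in A -> toggle C \in chains_in A.
Proof.
case/chains_inP=> CA chC; rewrite /toggle; case: ifP => tC.
  apply/chains_inP; split=> [|F G]; first exact: subset_trans (subD1set _ _) CA.
  by rewrite !inE => /andP[_ FC] /andP[_ GC]; exact: chC.
pose U := \bigcup_(S in C | i \notin S) S.
have U0C : U = set0 \/ (U \in C /\ i \notin U).
  have [S0 S0P|no] := pickP (fun S => (S \in C) && (i \notin S)); last first.
    by left; rewrite /U big_pred0.
  right; case: (@arg_maxnP _ S0 (fun S => (S \in C) && (i \notin S))
    (fun S => #|S|) S0P) => S /andP[SC iS] maxS.
  suff -> : U = S by [].
  apply/eqP; rewrite eqEsubset; apply/andP; split; last first.
    by apply: (bigcup_max S); rewrite ?SC.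
  apply/bigcupsP => S' S'P; have /andP[S'C _] := S'P.
  have /orP[//|SS'] := chC _ _ S'C SC.
  by have := maxS _ S'P; rewrite /geq /= => le; rewrite -(eqP (_ : S == S')) // eqEcard SS'.
have cmp S : S \in C -> (top C \subset S) || (S \subset top C).
  move=> SC; have [iS|iS] := boolP (i \in S); last first.
    by rewrite orbC (subset_trans _ (subsetUr _ _)) // (bigcup_max S) ?SC.
  apply/orP; left; rewrite subUset sub1set iS /=; rewrite -/U.
  have [->|[UC iU]] := U0C; first exact: sub0set.
  have /orP[//|/subsetP/(_ i iS)] := chC _ _ UC SC.
  by rewrite (negbTE iU).
apply/chains_inP; split.
  rewrite subUset sub1set CA andbT /top -/U.
  have [->|[UC _]] := U0C; first by rewrite setU0.
  exact/Acone/(subsetP CA).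
move=> F G; rewrite !inE => /orP[/eqP->|FC] /orP[/eqP->|GC].
- by rewrite subxx.
- exact: cmp.
- by rewrite orbC; exact: cmp.
- exact: chC.
Qed.

(** [toggle] pairs chains of opposite sign. Topologically, the order complex contracts to
    [[set i]]. *)
Lemma alt_chains_cone : alt_chains A = 0.
Proof.
suff : alt_chains A = - alt_chains A by lia.
rewrite {1}/alt_chains (reindex_inj (inv_inj toggleK)) /= -sumrN.
apply: eq_big => [C|C _].
  by apply/idP/idP => [/chain_toggle|]; rewrite ?toggleK //; exact: chain_toggle.
rewrite /toggle; case: ifP => tC; last by rewrite cardsU1 tC exprS mulN1r.
by rewrite [in RHS](cardsD1 (top C) C) tC exprS mulN1r opprK.
Qed.

End Toggle.

Definition proper_subsets D := [set S | (S != set0) && (S \proper D)].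

Lemma alt_chains0 : alt_chains set0 = 1.
Proof.
rewrite /alt_chains (big_pred1 set0) ?cards0 // => C.
apply/chains_inP/eqP => [[]|->]; first by rewrite subset0 => /eqP.
by split=> // F G; rewrite inE.
Qed.

(** The order complex is a sphere, the subdivided boundary of a simplex. With [E] the complement of
    a point [i], the chains avoiding [E] cancel by the cone argument, and those containing [E] are
    chains of proper subsets of [E] with [E] added. *)
Lemma alt_chains_proper D : alt_chains (proper_subsets D) = (-1) ^+ #|D|.-1.
Proof.
have [k] := ubnP #|D|; elim: k D => // k IHk D; rewrite ltnS => leD.
have [D1|D1] := leqP #|D| 1.
  suff -> : proper_subsets D = set0.
    by rewrite alt_chains0; case: #|D| D1 => [|[]].
  apply/setP => S; rewrite !inE; apply/negP => /andP[S0 /proper_card].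
  by rewrite ltnNge (leq_trans D1) // card_gt0.
have [i iD] : exists i, i \in D by apply/set0Pn; rewrite -card_gt0 ltnW.
set E := D :\ i; have cD : #|D| = #|E|.+1 by rewrite (cardsD1 i) iD.
have iE : i \notin E by rewrite !inE eqxx.
have ED : E \proper D by apply: properD1.
have E0 : E != set0 by rewrite -card_gt0 -ltnS -cD.
have EP : E \in proper_subsets D by rewrite inE E0.
have cone : alt_chains (proper_subsets D :\ E) = 0.
  apply: (@alt_chains_cone _ i).
    rewrite !inE -card_gt0 cards1 /=; apply/andP; split.
      by apply: contraNneq iE => <-; rewrite set11.
    by rewrite properEcard sub1set iD cards1.
  move=> S; rewrite !inE => /and3P[SE S0 SD].
  have -> : i |: S != E by apply: contraNneq iE => <-; rewrite setU11.
  have -> : i |: S != set0 by apply/set0Pn; exists i; rewrite setU11.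
  rewrite properEneq subUset sub1set iD (proper_sub SD) !andbT /=.
  (* Adding [i] gives all of [D] only for [S = E], which has been removed. *)
  apply: contraNneq SE => e; apply/eqP; rewrite /E -e setU1K //.
  by apply: contraTN SD => iS; rewrite properE negb_and negbK -{2}e subUset sub1set iS subxx orbT.
rewrite /alt_chains (bigID (fun C => E \in C)) /= addrC.
rewrite [X in X + _](_ : _ = 0); last first.
  rewrite -[RHS]cone /alt_chains; apply: eq_bigl => C; apply/andP/chains_inP.
    case=> /chains_inP[CA chC] EC; split=> //.
    by rewrite subsetD1 CA.
  by rewrite subsetD1 => -[/andP[CA EC] chC]; split=> //; apply/chains_inP.
rewrite add0r (reindex_onto (fun C => E |: C) (fun C => C :\ E)) /=; last first.
  by move=> C /andP[_ EC]; rewrite setD1K.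
have -> : #|D|.-1 = #|E|.-1.+1 by rewrite cD prednK // card_gt0.
rewrite exprS mulN1r -IHk; last by rewrite -cD.
rewrite /alt_chains -sumrN; apply: eq_big => C; last first.
  case/andP=> _ /eqP e; suff EC : E \notin C by rewrite cardsU1 EC exprS mulN1r.
  by rewrite -e setD11.
rewrite setU11 andbT; apply/andP/chains_inP.
  case=> /chains_inP[CA chC] /eqP e.
  have EC : E \notin C by rewrite -e setD11.
  split=> [|F G FC GC]; last by apply: chC; rewrite inE ?FC ?GC orbT.
  apply/subsetP => F FC; have : F \in proper_subsets D.
    by rewrite (subsetP CA) // inE FC orbT.
  rewrite !inE => /andP[-> FD] /=.
  have FE : F != E by apply: contraNneq EC => <-.
  rewrite properEneq FE /=.
  have /orP[//|EF] : (F \subset E) || (E \subset F).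
    by apply: chC; rewrite !inE ?FC ?eqxx ?orbT.
  have /proper_card : E \proper F by rewrite properEneq eq_sym FE.
  by move/proper_card: FD; rewrite cD ltnS ltnNge => ->.
case=> CA chC.
have EC : E \notin C.
  by apply: contraTN isT => /(subsetP CA); rewrite inE properxx andbF.
split; last by rewrite setU1K.
have subE F : F \in C -> F \subset E.
  by move=> /(subsetP CA); rewrite inE => /andP[_ /proper_sub].
apply/chains_inP; split.
  rewrite subUset sub1set EP; apply/subsetP => F /(subsetP CA).
  by rewrite !inE => /andP[-> FE]; exact: proper_trans FE ED.
move=> F G; rewrite !inE => /orP[/eqP->|FC] /orP[/eqP->|GC].
- by rewrite subxx.
- by rewrite (subE _ GC) orbT.
- by rewrite (subE _ FC).
- exact: chC.
Qed.

(* If [y] is not zero then some [y i] is negative, and adding [i] preserves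
   the sets with nonpositive sum. *)
Lemma alt_chains_nonpos (R : realDomainType) (y : T -> R) : \sum_i y i = 0 ->
  alt_chains [set S in proper_subsets [set: T] | \sum_(i in S) y i <= 0] =
  if [forall i, y i == 0] then (-1) ^+ #|T|.-1 else 0.
Proof.
move=> y0; case: ifP => [/forallP yz|/negbT].
  rewrite -cardsT -alt_chains_proper; congr alt_chains.
  apply/setP => S; rewrite [in LHS]inE big1 ?lexx ?andbT // => i _; exact/eqP.
rewrite negb_forall => /existsP[i1 yi1].
have [i yi] : exists i, y i < 0.
  apply/existsP; apply: contraNT yi1 => /existsPn ge0.
  have /psumr_eq0P h : forall i, true -> 0 <= y i by move=> i _; rewrite leNgt.
  by rewrite h.
have ysetT S : \sum_(j in S) y j < 0 -> S \proper [set: T].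
  move=> lt; rewrite properT; apply: contraTneq lt => ->.
  by rewrite -leNgt; under eq_bigl do rewrite inE; rewrite y0.
have nonempty S : i |: S != set0 by apply/set0Pn; exists i; rewrite setU11.
apply: (@alt_chains_cone _ i).
  by rewrite !inE -[[set i]]setU0 nonempty ysetT setU0 big_set1 ?ltW.
move=> S SA; have [iS|iS] := boolP (i \in S).
  by rewrite (setUidPr _) // sub1set.
move: SA; rewrite !inE => /andP[_ yS].
have lt : \sum_(j in i |: S) y j < 0 by rewrite big_setU1 // ltr_wnDr.
by rewrite nonempty ysetT // ltW.
Qed.

End AlternatingChains.

From mathcomp Require Import boolp classical_sets reals numfun.
From mathcomp Require Import topology normedtype derive.
Import numFieldNormedType.Exports.

(** * Euler characteristic *)

Section Euler.
Local Open Scope classical_set_scope.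
Local Open Scope ring_scope.
Variable R : realType.

Definition convex_set n (K : set 'rV[R]_n) :=
  forall x y t, K x -> K y -> 0 <= t <= 1 -> K (t *: x + (1 - t) *: y).

Definition lfun n (u : 'I_n -> R) (x : 'rV[R]_n) : R := \sum_i u i * x 0 i.

Lemma lfun_comb n (u : 'I_n -> R) I (r : seq I) (P : pred I) (w : I -> R) v :
  lfun u (\sum_(i <- r | P i) w i *: v i) =
  \sum_(i <- r | P i) w i * lfun u (v i).
Proof.
rewrite /lfun.
under [RHS]eq_bigr => i _ do rewrite mulr_sumr.
rewrite exchange_big /=; apply: eq_bigr => j _.
by rewrite summxE mulr_sumr; apply: eq_bigr => i _; rewrite mxE mulrCA.
Qed.

Lemma lfunD n (u : 'I_n -> R) x y s t :
  lfun u (s *: x + t *: y) = s * lfun u x + t * lfun u y.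
Proof.
rewrite /lfun !mulr_sumr -big_split; apply: eq_bigr => j _ /=.
by rewrite !mxE mulrDr mulrCA [u j * (t * _)]mulrCA.
Qed.

Lemma lfun_continuous n (u : 'I_n -> R) : continuous (lfun u).
Proof.
apply: continuous_big => [|i _ x]; first exact: add_continuous.
exact: cvgMl_tmp (@coord_continuous R 1 n 0 i x).
Qed.

Lemma slice_compact n (K : set 'rV[R]_n) u s :
  compact K -> compact (K `&` [set x | lfun u x = s]).
Proof.
move=> cK; apply: compact_closedI => //.
have /continuous_closedP clP := @lfun_continuous n u.
exact: (clP [set t | t = s] (@closed_eq R s)).
Qed.

Lemma slice_convex n (K : set 'rV[R]_n) u s :
  convex_set K -> convex_set (K `&` [set x | lfun u x = s]).
Proof.
move=> cK x y t [Kx /= <-] [Ky /= yx] t01; split; first exact: cK.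
by rewrite /= lfunD yx; ring.
Qed.

(** The hull is a continuous image of a slice of a cube; the coordinates outside [A] range freely
    over [[0, 1]] and do not affect the image. *)
Lemma finite_conv_compact n (J : finType) (A : {set J}) (v : J -> 'rV[R]_n) :
  compact [set x | exists w : J -> R, [/\ forall i, i \in A -> 0 <= w i,
    \sum_(i in A) w i = 1 & x = \sum_(i in A) w i *: v i]].
Proof.
pose S := [set w : 'rV[R]_#|J| | forall i, w 0 i \in `[0, 1]] `&`
  [set w | lfun (fun i => (enum_val i \in A)%:R) w = 1].
pose f (w : 'rV[R]_#|J|) := \sum_(i in A) w 0 (enum_rank i) *: v i.
suff -> : [set x | exists w : J -> R, [/\ forall i, i \in A -> 0 <= w i,
    \sum_(i in A) w i = 1 & x = \sum_(i in A) w i *: v i]] = f @` S.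
  apply: continuous_compact.
    apply: continuous_subspaceT.
    apply: continuous_big => [|i _ x]; first exact: add_continuous.
    exact: cvgZr_tmp (@coord_continuous R 1 #|J| 0 (enum_rank i) x).
  apply: slice_compact.
  have cc := rV_compact (fun _ : 'I_#|J| => @segment_compact R 0 1).
  exact: cc.
have sumE (w : 'rV[R]_#|J|) :
    lfun (fun i => (enum_val i \in A)%:R) w = \sum_(i in A) w 0 (enum_rank i).
  rewrite /lfun (reindex enum_rank) /=; last exact/onW_bij/enum_rank_bij.
  rewrite [RHS]big_mkcond; apply: eq_bigr => i _.
  by rewrite enum_rankK; case: ifP => _; rewrite ?mul1r ?mul0r.
apply/seteqP; split=> x /=.
  case=> w [w0 w1 ->].
  exists (\row_i (if enum_val i \in A then w (enum_val i) else 0)).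
    split=> /=.
      move=> i; rewrite mxE; case: ifP => iA; last by rewrite in_itv /= lexx ler01.
      rewrite in_itv /= w0 // -w1 (bigD1 (enum_val i)) //= lerDl.
      by apply: sumr_ge0 => j /andP[jA _]; exact: w0.
    by rewrite sumE -w1; apply: eq_bigr => i iA; rewrite mxE enum_rankK iA.
  by apply: eq_bigr => i iA; rewrite mxE enum_rankK iA.
case=> w [/= w01 w1] <-; exists (fun i => w 0 (enum_rank i)).
split=> //; last by rewrite -sumE.
by move=> i _; have := w01 (enum_rank i); rewrite in_itv /= => /andP[].
Qed.

Definition attained n (K : set 'rV[R]_n) (u : 'I_n -> R) (s : R) :=
  `[< exists2 x, K x & lfun u x = s >].

Definition is_max n (K : set 'rV[R]_n) (u : 'I_n -> R) (s : R) :=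
  attained K u s && `[< forall x, K x -> lfun u x <= s >].

Lemma attained_interval n (K : set 'rV[R]_n) u :
  K !=set0 -> compact K -> convex_set K ->
  exists a b, forall s, attained K u s = (a <= s <= b).
Proof.
move=> K0 cK vK.
have cu : {within K, continuous (lfun u)}.
  by apply: continuous_subspaceT; exact: lfun_continuous.
have [p pK maxp] := compact_EVT_max K0 cK cu.
have [q qK minq] := compact_EVT_min K0 cK cu.
exists (lfun u q), (lfun u p) => s; apply/asboolP/idP.
  by case=> x /mem_set xK <-; rewrite minq ?maxp.
move=> /andP[qs sp]; rewrite inE in pK; rewrite inE in qK.
have [e|ne] := eqVneq (lfun u q) (lfun u p).
  by exists q => //; apply/eqP; rewrite eq_le qs e.
have lt : 0 < lfun u p - lfun u q.
  by rewrite subr_gt0 lt_neqAle ne (le_trans qs).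
set t := (s - lfun u q) / (lfun u p - lfun u q).
exists (t *: p + (1 - t) *: q); last first.
  by rewrite lfunD /t; field; rewrite gt_eqF.
apply: vK => //; rewrite /t divr_ge0 ?(ltW lt) ?subr_ge0 //=.
by rewrite ler_pdivrMr // mul1r lerD2r.
Qed.

(** The attained values form a compact interval, so just to the right of [s] nothing changes unless
    [s] is its right endpoint. *)
Lemma attained_right n (K : set 'rV[R]_n) u s :
  compact K -> convex_set K ->
  exists2 e, 0 < e & forall e', 0 < e' <= e ->
    attained K u (s + e') = attained K u s && ~~ is_max K u s.
Proof.
move=> cK vK; rewrite /is_max.
have [->|K0] := eqVneq K set0.
  exists 1 => // e' _.
  have E t : attained set0 u t = false by apply/asboolPn => -[].
  by rewrite !E.
have {K0} K0 : K !=set0 by apply/set0P.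
have [a [b ab]] := attained_interval u K0 cK vK.
have maxE : `[< forall x, K x -> lfun u x <= s >] = (b <= s).
  apply/asboolP/idP => [h|bs x Kx].
    have [x0 Kx0] := K0.
    have : attained K u (lfun u x0) by apply/asboolP; exists x0.
    rewrite ab => /andP[ax xb].
    have : attained K u b by rewrite ab lexx (le_trans ax).
    by case/asboolP => x Kx <-; exact: h.
  have : attained K u (lfun u x) by apply/asboolP; exists x.
  by rewrite ab => /andP[_ /le_trans]; apply.
rewrite maxE !ab.
have [sa|as_] := ltP s a.
  (* Halving keeps [s + e'] strictly below the left endpoint [a]. *)
  exists ((a - s) / 2) => [|e' /andP[e0 e1]]; first by rewrite divr_gt0 ?subr_gt0.
  by rewrite ab; apply/negbTE; rewrite negb_and -!ltNge; lra.
have [bs|sb] := leP b s.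
  exists 1 => // e' /andP[e0 _]; rewrite ab /= andbT andbN.
  by apply/negbTE; rewrite negb_and -!ltNge; lra.
exists (b - s) => [|e' /andP[e0 e1]]; first by rewrite subr_gt0.
by rewrite ab (ltW sb) /=; lra.
Qed.

Section Families.
Variables (n : nat) (J : finType) (d : J -> R).

(* The Euler characteristic of a compact interval is the number of its right
   endpoints: the indicator function drops by 1 there and nowhere else. *)
Lemma slices_zero_max (K : J -> set 'rV[R]_n) u :
  (forall j, compact (K j)) -> (forall j, convex_set (K j)) ->
  (forall s, \sum_(j | attained (K j) u s) d j = 0) ->
  forall s, \sum_(j | is_max (K j) u s) d j = 0.
Proof.
move=> cK vK h s.
have /choice[e eP] j : exists e, 0 < e /\ forall e', 0 < e' <= e ->
    attained (K j) u (s + e') = attained (K j) u s && ~~ is_max (K j) u s.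
  by have [e e0 eP] := attained_right u s (cK j) (vK j); exists e.
(* One step to the right that suits all members of the finite family; the default 1 keeps it
   positive. *)
pose e0 := \big[Num.min/1]_j e j.
have e0_gt0 : 0 < e0 by apply: lt_bigmin => // j _; case: (eP j).
have e0P j : attained (K j) u (s + e0) = attained (K j) u s && ~~ is_max (K j) u s.
  by have [_ ->] := eP j; rewrite // e0_gt0; exact: bigmin_le.
suff -> : \sum_(j | is_max (K j) u s) d j =
    \sum_(j | attained (K j) u s) d j - \sum_(j | attained (K j) u (s + e0)) d j.
  by rewrite !h subrr.
rewrite big_mkcond [in RHS]big_mkcond [X in _ - X]big_mkcond.
rewrite -sumrB; apply: eq_bigr => j _.
rewrite e0P /is_max; case: (attained _ _ _) => /=; last by rewrite subrr.
by case: `[< _ >]; rewrite /= ?subrr ?subr0.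
Qed.

(** A nonempty member has exactly one maximal value of [u], so the sum splits according to that
    value. *)
Lemma slices_zero_nonempty (K : J -> set 'rV[R]_n) u :
  (forall j, compact (K j)) -> (forall j, convex_set (K j)) ->
  (forall s, \sum_(j | attained (K j) u s) d j = 0) ->
  \sum_(j | `[< K j !=set0 >]) d j = 0.
Proof.
move=> cK vK h; have maxK := slices_zero_max cK vK h.
have uniq_max j s t : is_max (K j) u s -> is_max (K j) u t -> s = t.
  move=> /andP[/asboolP[x Kx <-] /asboolP mx] /andP[/asboolP[y Ky <-] /asboolP my].
  by apply/eqP; rewrite eq_le mx ?my.
have ex_max j : K j !=set0 -> exists s, is_max (K j) u s.
  move=> K0; have [a [b ab]] := attained_interval u K0 (cK j) (vK j).
  have [x Kx] := K0.
  have : attained (K j) u (lfun u x) by apply/asboolP; exists x.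
  rewrite ab => /andP[ax xb]; exists b.
  rewrite /is_max ab lexx (le_trans ax) //; apply/asboolP => y Ky.
  have : attained (K j) u (lfun u y) by apply/asboolP; exists y.
  by rewrite ab => /andP[].
have /choice[b bP] j : exists s, K j !=set0 -> is_max (K j) u s.
  by have [/ex_max[s]|] := pselect (K j !=set0); [exists s | exists 0].
(* A canonical index with the same maximal value, so that the sum is partitioned over a finite type.
   Empty members carry an arbitrary value and are filtered out separately. *)
pose p j := odflt j [pick i | b i == b j].
have bp j : b (p j) = b j.
  by rewrite /p; case: pickP => [i /eqP|].
have pE j j' : b j = b j' -> p j = p j'.
  by rewrite /p => ->; case: pickP => // /(_ j'); rewrite eqxx.
rewrite (partition_big p predT) //=; apply: big1 => i _.
have [j0 /andP[/asboolP K0 /eqP p0]|no] :=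
    pickP (fun j => `[< K j !=set0 >] && (p j == i)); last exact: big_pred0.
rewrite -[RHS](maxK (b i)); apply: eq_bigl => j.
apply/andP/idP => [[/asboolP Kj /eqP <-]|mj]; first by rewrite bp; exact: bP.
have Kj : K j !=set0 by case/andP: mj => /asboolP[x Kx _] _; exists x.
split; first exact/asboolP.
by rewrite -p0; apply/eqP/pE; rewrite (uniq_max _ _ _ (bP j Kj) mj) -p0 bp.
Qed.

(* Induction on the number of coordinates that are not yet fixed. *)
Lemma euler_nonempty (K : J -> set 'rV[R]_n) :
  (forall j, compact (K j)) -> (forall j, convex_set (K j)) ->
  (forall x, \sum_(j | `[< K j x >]) d j = 0) ->
  \sum_(j | `[< K j !=set0 >]) d j = 0.
Proof.
(* The coordinates from [k] on agree with those of [t]. At [k = 0] every member is empty or the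
   single point [t], and the pointwise hypothesis at [t] is the claim. *)
suff main k (t : 'rV[R]_n) (K' : J -> set 'rV[R]_n) : (forall j, compact (K' j)) ->
    (forall j, convex_set (K' j)) ->
    (forall x, \sum_(j | `[< K' j x >]) d j = 0) ->
    (forall j x (i : 'I_n), K' j x -> (k <= i)%N -> x 0 i = t 0 i) ->
    \sum_(j | `[< K' j !=set0 >]) d j = 0.
  move=> cK vK zK; apply: (main n 0 K) => // j x i _.
  by rewrite leqNgt ltn_ord.
elim: k => [|k IHk] in t K' * => cK vK zK fixK.
  rewrite -[RHS](zK t); apply: eq_bigl => j; apply: asbool_equiv_eq.
  split=> [[x Kx]|Kt]; last by exists t.
  by suff <- : x = t by []; apply/rowP => i; apply: fixK Kx _.
have [kn|nk] := ltnP k n; last first.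
  apply: (IHk t) => // j x i _ ki.
  by have := leq_ltn_trans (leq_trans nk ki) (ltn_ord i); rewrite ltnn.
pose ik := Ordinal kn; pose u i : R := (i == ik)%:R.
have uE x : lfun u x = x 0 ik.
  rewrite /lfun (bigD1 ik) //= /u eqxx mul1r big1 ?addr0 // => i /negbTE->.
  by rewrite mul0r.
apply: (slices_zero_nonempty (u := u)) => // s.
pose Ks j := K' j `&` [set x | lfun u x = s].
rewrite -[RHS](IHk (\row_i if i == ik then s else t 0 i) Ks).
- apply: eq_bigl => j; apply: asbool_equiv_eq.
  by split=> [[x Kx xs]|[x [Kx xs]]]; exists x.
- by move=> j; exact: slice_compact.
- by move=> j; exact: slice_convex.
- move=> x; have [xs|xs] := eqVneq (lfun u x) s.
    rewrite -[RHS](zK x); apply: eq_bigl => j; apply: asbool_equiv_eq.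
    by split=> [[]|].
  apply: big_pred0 => j; apply/asboolPn => -[_ /= e].
  by rewrite e eqxx in xs.
- move=> j x i [Kx /= xs] ki; rewrite mxE.
  case: eqVneq => [->|ne]; first by rewrite -uE.
  apply: fixK Kx _; rewrite ltn_neqAle ki andbT.
  by apply: contraNneq ne => e; apply/eqP/val_inj.
Qed.

(** Slices by a hyperplane satisfy the same pointwise relation, so [euler_nonempty] supplies what
    [slices_zero_max] asks for. *)
Lemma euler_max (K : J -> set 'rV[R]_n) u :
  (forall j, compact (K j)) -> (forall j, convex_set (K j)) ->
  (forall x, \sum_(j | `[< K j x >]) d j = 0) ->
  forall s, \sum_(j | is_max (K j) u s) d j = 0.
Proof.
move=> cK vK zK; apply: slices_zero_max => // s.
pose Ks j := K j `&` [set x | lfun u x = s].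
rewrite -[RHS](@euler_nonempty Ks).
- apply: eq_bigl => j; apply: asbool_equiv_eq.
  by split=> [[x Kx xs]|[x [Kx xs]]]; exists x.
- by move=> j; exact: slice_compact.
- by move=> j; exact: slice_convex.
- move=> x; have [xs|xs] := eqVneq (lfun u x) s.
    rewrite -[RHS](zK x); apply: eq_bigl => j; apply: asbool_equiv_eq.
    by split=> [[]|].
  apply: big_pred0 => j; apply/asboolPn => -[_ /= e].
  by rewrite e eqxx in xs.
Qed.

End Families.
End Euler.

(** * Base polytopes *)

Definition laminar (T : finType) (L : {set {set T}}) : Prop :=
  forall F G, F \in L -> G \in L ->
  [|| F \subset G, G \subset F | [disjoint F & G]].

Section ConvHull.
Local Open Scope ring_scope.
Variables (R : realType) (n : nat).
Implicit Types (A : set 'rV[R]_n) (x y : 'rV[R]_n).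

Lemma conv_hull_pt A x : A x -> conv_hull A x.
Proof.
move=> Ax; exists 1%N, (fun=> 1), (fun=> x).
by split=> [_|||]; rewrite ?ler01 ?big_ord1 ?scale1r.
Qed.

Lemma conv_hullS A A' : (A `<=` A')%classic -> (conv_hull A `<=` conv_hull A')%classic.
Proof. by move=> AA' x [p [w [v [w0 w1 Av ->]]]]; exists p, w, v; split=> // i; exact: AA'. Qed.

Lemma conv_hull_convex A : convex_set (conv_hull A).
Proof.
move=> _ _ t [p [w [v [w0 w1 Av ->]]]] [q [w' [v' [w'0 w'1 Av' ->]]]] /andP[t0 t1].
exists (p + q)%N,
  (fun k => match fintype.split k with inl i => t * w i | inr j => (1 - t) * w' j end),
  (fun k => match fintype.split k with inl i => v i | inr j => v' j end).
have El i : fintype.split (lshift q i) = inl i :> 'I_p + 'I_q := unsplitK (inl i).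
have Er i : fintype.split (rshift p i) = inr i :> 'I_p + 'I_q := unsplitK (inr i).
split=> [k||k|].
- by case: (fintype.split k) => i; rewrite mulr_ge0 // subr_ge0.
- rewrite big_split_ord /=.
  under eq_bigr do rewrite El; under [X in _ + X]eq_bigr do rewrite Er.
  by rewrite -!mulr_sumr w1 w'1; ring.
- by case: (fintype.split k).
- rewrite big_split_ord /=.
  under [in RHS]eq_bigr do rewrite El.
  under [X in _ = _ + X]eq_bigr do rewrite Er.
  by rewrite !scaler_sumr; congr (_ + _); apply: eq_bigr => i _; rewrite scalerA.
Qed.

End ConvHull.

(** * Integral rounding along a laminar family *)

Section Rounding.
Local Open Scope ring_scope.
Variables (R : realType) (n : nat) (L : {set {set 'I_n}}).
Implicit Types (x y : 'rV[R]_n) (i j : 'I_n) (F G : {set 'I_n}).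
Hypothesis lamL : laminar L.
Hypothesis singL : forall i, [set i]%SET \in L.
Hypothesis topL : [set: 'I_n]%SET \in L.

Definition sumOn (x : 'rV[R]_n) (G : {set 'I_n}) : R := \sum_(i in G) x 0 i.

(** Each sum of [y] lies between the floor and the ceiling of that of [x]; with integer bounds
    instead, transitivity is immediate. *)
Definition rounds (x y : 'rV[R]_n) := forall G (z : int), G \in L ->
  (z%:~R <= sumOn x G -> z%:~R <= sumOn y G) /\
  (sumOn x G <= z%:~R -> sumOn y G <= z%:~R).

Definition fractional (x : 'rV[R]_n) : {set {set 'I_n}} :=
  [set G in L | sumOn x G \isn't a Num.int]%SET.

Lemma sumOn1 x i : sumOn x [set i]%SET = x 0 i.
Proof. by rewrite /sumOn big_set1. Qed.

Lemma sumOnD s t x y G : sumOn (s *: x + t *: y) G = s * sumOn x G + t * sumOn y G.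
Proof.
rewrite /sumOn !mulr_sumr -big_split; apply: eq_bigr => i _.
by rewrite !mxE.
Qed.

Lemma sumOn_delta i G : sumOn (delta_mx 0 i) G = (i \in G)%:R.
Proof.
rewrite /sumOn; have [iG|iG] := boolP (i \in G).
  rewrite (bigD1 i) //= big1 ?addr0 ?mxE ?eqxx // => j /andP[_ /negbTE ji].
  by rewrite !mxE ji andbF.
rewrite big1 // => j jG; rewrite !mxE [j == i](_ : _ = false) ?andbF //.
by apply: contraNF iG => /eqP<-.
Qed.

Definition edge i j : 'rV[R]_n := delta_mx 0 i - delta_mx 0 j.

(** Mass moves from [j] to [i] until the first member of [L] separating them reaches an integer sum.
    Integral members do not separate them, so no new fractional member appears. *)
Lemma rounding_step x i j :
  x 0 i \isn't a Num.int -> i != j ->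
  (forall G, G \in L -> sumOn x G \is a Num.int -> (i \in G) = (j \in G)) ->
  exists s, [/\ 0 < s, rounds x (x + s *: edge i j) &
    (#|fractional (x + s *: edge i j)| < #|fractional x|)%N].
Proof.
move=> xi ij sep.
have sumE s G : sumOn (x + s *: edge i j) G = sumOn x G + s * ((i \in G)%:R - (j \in G)%:R).
  rewrite -[x in LHS]scale1r sumOnD mul1r; congr (_ + _ * _).
  by rewrite /edge -[delta_mx 0 i]scale1r -scaleN1r sumOnD !sumOn_delta mul1r mulN1r.
(* For a separating [G], the distance to the next integer in the direction of motion: upwards if [G]
   contains [i], downwards if it contains [j]. *)
pose gap G := if i \in G then (Num.ceil (sumOn x G))%:~R - sumOn x G
              else sumOn x G - (Num.floor (sumOn x G))%:~R.
pose P := [pred G | (G \in L) && ((i \in G) != (j \in G))].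
have P0 : P [set i]%SET by rewrite /= singL !inE eqxx [j == i]eq_sym (negbTE ij).
have [G0 /andP[G0L G0ij] minG0] := arg_minP gap P0.
have notint G : G \in L -> (i \in G) != (j \in G) -> sumOn x G \isn't a Num.int.
  by move=> GL; apply: contraNN => GZ; rewrite (sep G GL GZ).
exists (gap G0); split.
- have := notint _ G0L G0ij; rewrite /gap; case: ifP => _ h.
    by rewrite subr_gt0 lt_neqAle ceil_ge andbT eq_sym -intrEceil.
  by rewrite subr_gt0 lt_neqAle floor_le andbT -intrEfloor.
- have g0 : 0 <= gap G0.
    by rewrite /gap; case: ifP; rewrite subr_ge0 ?ceil_ge ?floor_le.
  move=> G z GL; rewrite sumE.
  have [ijG|ijG] := eqVneq (i \in G) (j \in G); first by rewrite ijG subrr mulr0 addr0.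
  have := minG0 G; rewrite /= GL ijG => /(_ isT); rewrite {2}/gap.
  move: ijG; case: (i \in G); case: (j \in G) => //= _ le; split=> h; [lra| |  |lra].
    by rewrite -ceil_le_int -(ler_int R) in h; lra.
  by rewrite -floor_ge_int -(ler_int R) in h; lra.
- apply: proper_card; apply/properP; split.
    apply/fintype.subsetP => G; rewrite !inE sumE => /andP[GL]; rewrite GL.
    have [->|ijG _] := eqVneq (i \in G) (j \in G); first by rewrite subrr mulr0 addr0.
    exact: notint.
  exists G0; first by rewrite inE G0L notint.
  rewrite inE G0L negbK sumE /gap; move: G0ij.
  case: (i \in G0); case: (j \in G0) => //= _.
    by rewrite subr0 mulr1 addrC subrK intr_int.
  by rewrite sub0r mulrN1 opprB addrC subrK intr_int.
Qed.

Lemma rounds_trans y x z : rounds x y -> rounds y z -> rounds x z.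
Proof.
by move=> xy yz G t GL; have [a b] := xy G t GL; have [c d] := yz G t GL; split; auto.
Qed.

(** Take a smallest integral member [F] of [L] with a fractional entry; its integral sum forces a
    second one. An integral member meeting [F] in a fractional entry contains [F], or lies inside it
    and equals it by minimality. *)
Lemma fractional_pair x : sumOn x [set: 'I_n]%SET \is a Num.int ->
  fractional x != finset.set0 ->
  exists i j, [/\ x 0 i \isn't a Num.int, x 0 j \isn't a Num.int, i != j &
    forall G, G \in L -> sumOn x G \is a Num.int -> (i \in G) = (j \in G)].
Proof.
move=> xT /finset.set0Pn[G1]; rewrite inE => /andP[G1L G1x].
have exfrac G : sumOn x G \isn't a Num.int -> exists2 i, i \in G & x 0 i \isn't a Num.int.
  move=> h; apply/exists_inP; apply: contraNT h => /exists_inPn h.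
  by apply: rpred_sum => i /h; rewrite negbK.
have [i1 _ xi1] := exfrac _ G1x.
pose P := [pred F : {set 'I_n} | [&& F \in L, sumOn x F \is a Num.int &
  [exists i in F, x 0 i \isn't a Num.int]]].
have PT : P [set: 'I_n]%SET.
  by rewrite /= topL xT /=; apply/exists_inP; exists i1; rewrite ?inE.
have [F /and3P[FL FZ /exists_inP[i iF xi]] minF] := arg_minnP (fun F => #|F|) PT.
have [j /andP[jF ji] xj] : exists2 j, (j \in F) && (j != i) & x 0 j \isn't a Num.int.
  apply/exists_inP; apply: contraNT xi => /exists_inPn h.
  suff -> : x 0 i = sumOn x F - \sum_(j in F | j != i) x 0 j.
    by rewrite rpredB // rpred_sum // => j /h; rewrite negbK.
  by rewrite /sumOn (bigD1 i) //= addrK.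
have sep a b : a \in F -> b \in F -> x 0 a \isn't a Num.int ->
    forall G, G \in L -> sumOn x G \is a Num.int -> a \in G -> b \in G.
  move=> aF bF xa G GL GZ aG; have /or3P[/fintype.subsetP|GF|] := lamL FL GL.
  - by apply.
  - have FG : (#|F| <= #|G|)%N.
      by apply: minF; rewrite /= GL GZ; apply/exists_inP; exists a.
    by have -> : G = F by apply/eqP; rewrite eqEcard GF FG.
  - by move/disjointFr/(_ aF); rewrite aG.
exists i, j; split=> //; first by rewrite eq_sym.
by move=> G GL GZ; apply/idP/idP; apply: sep.
Qed.

Definition roundings x : set 'rV[R]_n :=
  [set y | rounds x y /\ forall G, G \in L -> sumOn y G \is a Num.int]%classic.

(** Moving mass between two fractional entries in either direction gives two points with fewer
    fractional members, and [x] lies on the segment joining them. *)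
Lemma laminar_rounding x : sumOn x [set: 'I_n]%SET \is a Num.int ->
  conv_hull (roundings x) x.
Proof.
have [k] := ubnP #|fractional x|; elim: k x => // k IHk x; rewrite ltnS => lek xT.
have [f0|fn0] := eqVneq (fractional x) finset.set0.
  apply: conv_hull_pt; split=> // G GL; apply: contraT => GZ.
  have : G \in fractional x by rewrite inE GL GZ.
  by rewrite f0 finset.in_set0.
have [i [j [xi xj ij sep]]] := fractional_pair xT fn0.
have [s [s0 rs fs]] := rounding_step xi ij sep.
have ji : j != i by rewrite eq_sym.
have [s' [s'0 rs' fs']] :=
  rounding_step xj ji (fun G GL GZ => esym (sep G GL GZ)).
set x1 := x + s *: _ in rs fs; set x2 := x + s' *: _ in rs' fs'.
have Txk y : rounds x y -> sumOn y [set: 'I_n]%SET \is a Num.int.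
  case/intrP: xT => z xz /(_ _ z topL); rewrite xz lexx => -[/(_ isT) a /(_ isT) b].
  by apply/intrP; exists z; apply/eqP; rewrite eq_le a b.
have mono y : rounds x y ->
    conv_hull (roundings y) y ->
    conv_hull (roundings x) y.
  move=> xy; apply: conv_hullS => z [yz zZ]; split=> //; exact: rounds_trans xy yz.
have h1 := mono _ rs (IHk _ (leq_trans fs lek) (Txk _ rs)).
have h2 := mono _ rs' (IHk _ (leq_trans fs' lek) (Txk _ rs')).
have ss' : s' + s != 0 by rewrite gt_eqF ?addr_gt0.
have xE : x = (s' / (s' + s)) *: x1 + (1 - s' / (s' + s)) *: x2.
  by rewrite /x1 /x2 /edge; apply/rowP => l; rewrite !mxE; field.
rewrite [X in conv_hull _ X]xE.
apply: conv_hull_convex => //; rewrite divr_ge0 ?(ltW s'0) ?addr_ge0 ?(ltW s0) ?(ltW s'0) //=.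
by rewrite ler_pdivrMr ?addr_gt0 // mul1r lerDl ltW.
Qed.

End Rounding.

(** * Base polytopes by inequalities *)

Section BasePolytope.
Local Open Scope ring_scope.
Variables (R : realType) (n : nat).
Implicit Types (M : matroid 'I_n) (x : 'rV[R]_n) (B F G : {set 'I_n}) (u : 'I_n -> R).

Lemma base_polytopeE M : @base_polytope R n M =
  [set x | exists w : {set 'I_n} -> R, [/\ forall B, B \in bases M -> 0 <= w B,
    \sum_(B in bases M) w B = 1 & x = \sum_(B in bases M) w B *: char_vec R B]]%classic.
Proof.
apply/seteqP; split=> x /=.
  case=> p [w [v [w0 w1 vM ->]]].
  have /choice[B BP] i : exists B, B \in bases M /\ v i = char_vec R B.
    by have [B] := vM i; exists B.
  have part (V : nmodType) (f : 'I_p -> V) :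
      \sum_(C in bases M) \sum_(i | B i == C) f i = \sum_i f i.
    by rewrite [RHS](partition_big B [in bases M]) //= => i _; case: (BP i).
  exists (fun C => \sum_(i | B i == C) w i); split=> [C _||].
  - exact: sumr_ge0.
  - by rewrite part.
  - rewrite -part; apply: eq_bigr => C _; rewrite scaler_suml.
    by apply: eq_bigr => i /eqP<-; have [_ ->] := BP i.
case=> w [w0 w1 ->].
exists #|bases M|, (fun i => w (enum_val i)), (fun i => char_vec R (enum_val i)).
split=> [i|||].
- exact/w0/enum_valP.
- by rewrite -big_enum_val.
- by move=> i; exists (enum_val i) => //; exact: enum_valP.
- by rewrite -(big_enum_val (fun B => w B *: char_vec R B)).
Qed.

Lemma base_polytope_compact M : compact (@base_polytope R n M).
Proof. by rewrite base_polytopeE; exact: finite_conv_compact. Qed.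

Lemma base_polytope_convex M : convex_set (@base_polytope R n M).
Proof. exact: conv_hull_convex. Qed.

Lemma base_polytope_vertex M B : B \in bases M -> base_polytope M (char_vec R B).
Proof. by move=> BM; apply: conv_hull_pt; exists B. Qed.

Lemma base_polytope_le M u c x :
  (forall B, B \in bases M -> lfun u (char_vec R B) <= c) ->
  base_polytope M x -> lfun u x <= c.
Proof.
move=> h; rewrite base_polytopeE => -[w [w0 w1 ->]].
rewrite lfun_comb -[leRHS]mul1r -w1 mulr_suml.
by apply: ler_sum => B BM; rewrite ler_wpM2l ?w0 ?h.
Qed.

Lemma sumOnE x G : sumOn x G = lfun (fun i => (i \in G)%:R) x.
Proof.
rewrite /sumOn /lfun big_mkcond; apply: eq_bigr => i _.
by case: (i \in G); rewrite ?mul1r ?mul0r.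
Qed.

Lemma sumOnNE x G : - sumOn x G = lfun (fun i => - (i \in G)%:R) x.
Proof. by rewrite sumOnE /lfun -sumrN; apply: eq_bigr => i _; rewrite mulNr. Qed.

Lemma sumOn_char_vec B G : sumOn (char_vec R B) G = #|G :&: B|%:R.
Proof.
rewrite /sumOn -sum1_card natr_sum big_mkcond [in RHS]big_mkcond.
apply: eq_bigr => i _; rewrite mxE inE.
by case: (i \in G) => //=; case: (i \in B).
Qed.

Lemma base_polytope_sumOn_le M G c x :
  (forall B, B \in bases M -> #|G :&: B|%:R <= c) ->
  base_polytope M x -> sumOn x G <= c.
Proof.
move=> h; rewrite sumOnE; apply: base_polytope_le => B BM.
by rewrite -sumOnE sumOn_char_vec h.
Qed.

Lemma base_polytope_sumOn_ge M G c x :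
  (forall B, B \in bases M -> c <= #|G :&: B|%:R) ->
  base_polytope M x -> c <= sumOn x G.
Proof.
move=> h Mx; rewrite -lerN2 sumOnNE; apply: base_polytope_le Mx => B BM.
by rewrite -sumOnNE lerN2 sumOn_char_vec h.
Qed.

(** All bases have the size of [B]. If [B] is not one of them, each meets it in at most [#|B|.-1]
    elements, a bound valid on the polytope but violated by [char_vec R B]. *)
Lemma base_polytope_char_vec M B :
  base_polytope M (char_vec R B) <-> B \in bases M.
Proof.
split; last exact: base_polytope_vertex.
move=> MB; have cB : #|B| = rank M.
  have [C CM] := exists_basis M.
  apply/eqP; rewrite -(eqr_nat R) -[B]finset.setTI -sumOn_char_vec eq_le.
  by rewrite (base_polytope_sumOn_le _ MB) ?(base_polytope_sumOn_ge _ MB) // => D /rank_basis->;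
    rewrite finset.setTI.
have : #|B|%:R <= sumOn (char_vec R B) B by rewrite sumOn_char_vec finset.setIid.
apply: contraTT => BM; rewrite -ltNge.
(* For empty [B] the predecessor is not smaller, but then every basis is empty as well. *)
have [B0|B0] := posnP #|B|.
  have [C CM] := exists_basis M; have := rank_basis CM.
  rewrite -cB B0 => /esym/cards0_eq C0; move/cards0_eq: B0 BM => ->.
  by rewrite -C0 CM.
apply: (@le_lt_trans _ _ (#|B|.-1)%:R); last by rewrite ltr_nat ltn_predL.
apply: base_polytope_sumOn_le MB => C CM; rewrite ler_nat -ltnS prednK //.
apply: proper_card; rewrite finset.properEneq finset.subsetIl andbT.
apply: contraNneq BM => /finset.setIidPl BC.
suff -> : B = C by [].
by apply/eqP; rewrite eqEcard BC cB (rank_basis CM) leqnn.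
Qed.

Lemma base_polytope_rank M x : base_polytope M x -> sumOn x [set: 'I_n]%SET = (rank M)%:R.
Proof.
move=> Mx; apply/eqP; rewrite eq_le.
by rewrite (base_polytope_sumOn_le _ Mx) ?(base_polytope_sumOn_ge _ Mx) // => D /rank_basis->;
    rewrite finset.setTI.
Qed.

(** Laminar systems with integral bounds are integral: a solution is a convex combination of
    roundings, which obey the same bounds and are characteristic vectors of bases. *)
Lemma base_polytope_laminar M (L : {set {set 'I_n}}) (a b : {set 'I_n} -> nat) x :
  laminar L ->
  (forall B, B \in bases M <-> #|B| = rank M /\
     forall G, G \in L -> (a G <= #|G :&: B| <= b G)%N) ->
  base_polytope M x <-> [/\ forall i, 0 <= x 0 i <= 1,
    sumOn x [set: 'I_n]%SET = (rank M)%:R &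
    forall G, G \in L -> (a G)%:R <= sumOn x G <= (b G)%:R].
Proof.
move=> lamL hM; split=> [Mx|[x01 xT xL]].
  split; first 1 last.
  - exact: base_polytope_rank.
  - move=> G GL; apply/andP; split.
      by apply: base_polytope_sumOn_ge Mx => B /hM[_ /(_ G GL)/andP[]]; rewrite ler_nat.
    by apply: base_polytope_sumOn_le Mx => B /hM[_ /(_ G GL)/andP[]]; rewrite ler_nat.
  - move=> i; rewrite -sumOn1; apply/andP; split.
      by apply: base_polytope_sumOn_ge Mx => B _; exact: ler0n.
    apply: base_polytope_sumOn_le Mx => B _; rewrite (ler_nat _ _ 1).
    by rewrite -(cards1 i) subset_leq_card // finset.subsetIl.
(* The singletons preserve the bounds 0 and 1 under rounding, the ground set preserves the rank. *)
pose L' := L :|: [set [set i]%SET | i : 'I_n]%SET :|: [set [set: 'I_n]%SET]%SET.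
have lamL' : laminar L'.
  have lam1 i G : ([set i]%SET \subset G) || [disjoint [set i]%SET & G].
    by rewrite finset.sub1set disjoints1 orbN.
  move=> F G; rewrite !inE => /orP[/orP[FL|/imsetP[i _ ->]]|/eqP->]; last first.
  - by rewrite finset.subsetT orbT.
  - by have /orP[->|->] := lam1 i G; rewrite ?orbT.
  case/orP=> [/orP[GL|/imsetP[i _ ->]]|/eqP->].
  - exact: lamL.
  - by rewrite [[disjoint F & _]]disjoint_sym; have /orP[->|->] := lam1 i F; rewrite ?orbT.
  - by rewrite finset.subsetT.
have singL' i : [set i]%SET \in L'.
  by rewrite !inE; apply/orP; left; apply/orP; right; apply/imsetP; exists i.
have topL' : [set: 'I_n]%SET \in L' by rewrite !inE eqxx orbT.
have LL' G : G \in L -> G \in L' by move=> GL; rewrite !inE GL.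
have xTZ : sumOn x [set: 'I_n]%SET \is a Num.int by rewrite xT natr_int.
apply: conv_hullS (laminar_rounding lamL' singL' topL' xTZ) => y [xy yZ].
have y01 i : y 0 i = 0 \/ y 0 i = 1.
  have := yZ _ (singL' i); rewrite sumOn1 => /intrP[z yz].
  have := xy _ 0 (singL' i); have := xy _ 1 (singL' i).
  rewrite !sumOn1 yz !ler_int; have /andP[-> ->] := x01 i.
  move=> [_ /(_ isT) z1] [/(_ isT) z0 _].
  have [->|->] : z = 0 \/ z = 1 by lia.
    by left.
  by right.
pose B := [set i | y 0 i == 1]%SET.
have yB : y = char_vec R B.
  apply/rowP => i; rewrite mxE inE.
  by have [->|->] := y01 i; rewrite ?eqxx // eq_sym oner_eq0.
exists B => //; apply/hM; split.
  have := xy _ (rank M)%:Z topL'; rewrite xT yB sumOn_char_vec finset.setTI.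
  rewrite -!pmulrn !ler_nat leqnn => -[/(_ isT) h1 /(_ isT) h2].
  by apply/eqP; rewrite eqn_leq h1 h2.
move=> G GL; have /andP[h1 h2] := xL G GL.
have [/(_ h1) h3 _] := xy G (a G)%:Z (LL' G GL).
have [_ /(_ h2) h4] := xy G (b G)%:Z (LL' G GL).
by move: h3 h4; rewrite yB sumOn_char_vec !ler_nat => -> ->.
Qed.

End BasePolytope.

(** * Relabelings and the symmetrized indicator function *)

Section Relabel.
Variables (T : finType) (s : {perm T}).

Lemma relabel_subproof (M : matroid T) :
  matroid_axiom [set s @: (B : {set T}) | B : {set T} in bases M]%SET.
Proof.
apply/andP; split.
  have [B BM] := exists_basis M.
  by apply/finset.set0Pn; exists (s @: B); apply/imsetP; exists B.
apply/forall_inP => _ /imsetP[X XM ->]; apply/forall_inP => _ /imsetP[Y YM ->].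
apply/forall_inP => _ /finset.setDP[/imsetP[x xX ->]].
rewrite mem_imset; last exact: perm_inj.
move=> xY; have [y [yY yX yM]] := basis_exchange XM YM xX xY.
apply/exists_inP; exists (s y).
  by rewrite inE !(mem_imset _ _ (@perm_inj _ s)) yY yX.
apply/imsetP; exists (y |: X :\ x)%SET => //.
apply/finset.setP => z; rewrite -[z](permKV s) !inE.
by rewrite !(mem_imset _ _ (@perm_inj _ s)) !inE !(inj_eq (@perm_inj _ s)).
Qed.

Definition relabel (M : matroid T) : matroid T := Matroid (relabel_subproof M).

Lemma mem_relabel (M : matroid T) (B : {set T}) : (s @: B \in bases (relabel M)) = (B \in bases M).
Proof. by rewrite (mem_imset _ _ (imset_inj (@perm_inj _ s))). Qed.

End Relabel.

Section SymIndic.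
Local Open Scope ring_scope.
Variables (R : realType) (n : nat).
Implicit Types (M : matroid 'I_n) (x : 'rV[R]_n).

Lemma col_perm_char_vec (s : 'S_n) (B : {set 'I_n}) :
  col_perm s (char_vec R (s @: B)) = char_vec R B.
Proof. by apply/rowP => i; rewrite !mxE mem_imset //; exact: perm_inj. Qed.

Lemma col_permVK (s : 'S_n) x : col_perm s^-1%g (col_perm s x) = x.
Proof. by apply/rowP => i; rewrite !mxE permKV. Qed.

Lemma lfun_col_perm (s : 'S_n) (u : 'I_n -> R) x :
  lfun u (col_perm s x) = lfun (u \o s^-1%g) x.
Proof.
rewrite /lfun [RHS](reindex_inj (@perm_inj _ s)) /=.
by apply: eq_bigr => i _; rewrite mxE permK.
Qed.

Lemma base_polytope_relabel (s : 'S_n) M x :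
  base_polytope M (col_perm s x) <-> base_polytope (relabel s M) x.
Proof.
split=> -[p [w [v [w0 w1 vM xE]]]].
  exists p, w, (fun i => col_perm s^-1%g (v i)); split=> //.
    move=> i; have [B BM ->] := vM i; exists (s @: B); first by rewrite mem_relabel.
    by rewrite -(col_permVK s (char_vec R (s @: B))) col_perm_char_vec.
  rewrite -(col_permVK s x) xE; apply/rowP => i; rewrite !(mxE, summxE).
  by apply: eq_bigr => j _; rewrite !mxE.
exists p, w, (fun i => col_perm s (v i)); split=> //.
  move=> i; have [_ /imsetP[B BM ->] ->] := vM i; exists B => //.
  exact: col_perm_char_vec.
rewrite xE; apply/rowP => i; rewrite !(mxE, summxE).
by apply: eq_bigr => j _; rewrite !mxE.
Qed.

(** [sym_indic] without its normalizing factor, with the permutation acting on the matroid instead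
    of the point. *)
Definition sym_count M x : R := \sum_(s : 'S_n) \1_(base_polytope (relabel s M)) x.

Lemma sym_indicE M x : sym_indic (base_polytope M) x = (n`!%:R)^-1 * sym_count M x.
Proof.
rewrite /sym_indic; congr (_ * _); apply: eq_bigr => s _.
rewrite !indicE; congr (_%:R); congr nat_of_bool.
by apply/idP/idP; rewrite !inE => /base_polytope_relabel.
Qed.

Lemma matroid_eq (T : finType) (M M' : matroid T) : bases M = bases M' -> M = M'.
Proof. exact: val_inj. Qed.

Lemma relabelM (s t : 'S_n) M : relabel s (relabel t M) = relabel (t * s)%g M.
Proof.
apply: matroid_eq; apply/finset.setP => B; rewrite -[B]finset.imset_id.
apply/imsetP/imsetP.
  case=> _ /imsetP[C CM ->] ->; exists C => //.
  by rewrite -finset.imset_comp; apply: eq_imset => i; rewrite /= permM.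
case=> C CM ->; exists (t @: C); first by rewrite mem_relabel.
by rewrite -finset.imset_comp; apply: eq_imset => i; rewrite /= permM.
Qed.

Lemma relabel1 M : relabel 1%g M = M.
Proof.
apply: matroid_eq; apply/finset.setP => B.
have e : (1%g : 'S_n) @: B = B.
  by rewrite -[RHS]finset.imset_id; apply: eq_imset => i; rewrite perm1.
by rewrite -{1}e mem_relabel.
Qed.

Lemma sym_count_relabel (t : 'S_n) M x : sym_count (relabel t M) x = sym_count M x.
Proof.
rewrite /sym_count [RHS](reindex_inj (h := fun s => (t * s)%g)); last exact: mulgI.
by apply: eq_bigr => s _; rewrite relabelM.
Qed.

Lemma isomorphic_relabel M M' : isomorphic M M' <-> exists s : 'S_n, M' = relabel s M.
Proof.
split=> [[f [bf fM]]|[s ->]]; last first.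
  by exists s; split=> [|B]; [exact: injF_bij perm_inj | rewrite mem_relabel].
have injf := bij_inj bf; exists (perm injf); apply: matroid_eq.
apply/finset.setP => B; have [g fK gK] := bf.
have -> : B = perm injf @: (g @: B).
  rewrite -finset.imset_comp -{1}[B]finset.imset_id; apply: eq_imset => i /=.
  by rewrite permE gK.
rewrite mem_relabel fM.
have -> // : perm injf @: (g @: B) = f @: (g @: B).
by apply: eq_imset => i; rewrite permE.
Qed.

End SymIndic.

(** * Linear independence of the nested matroids *)

Lemma digits_inj (W m : nat) (a b : 'I_m -> nat) :
  (forall i, a i < W) -> (forall i, b i < W) ->
  \sum_(i < m) W ^ i * a i = \sum_(i < m) W ^ i * b i -> a =1 b.
Proof.
elim: m a b => [|m IHm] a b aW bW; first by move=> _ [].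
have sumE (c : 'I_m.+1 -> nat) : \sum_(i < m.+1) W ^ i * c i =
    (\sum_(i < m) W ^ i * c (lift ord0 i)) * W + c ord0.
  rewrite big_ord_recl expn0 mul1n addnC big_distrl; congr (_ + _).
  by apply: eq_bigr => i _; rewrite /= expnS; lia.
rewrite !sumE => e.
have e0 : a ord0 = b ord0.
  by have := congr1 (modn^~ W) e; rewrite !modnMDl !modn_small.
move/eqP: e; rewrite e0 eqn_add2r eqn_pmul2r; last exact: leq_ltn_trans (aW ord0).
move=> /eqP/IHm{IHm} IH i.
have [j ->|->//] := unliftP ord0 i.
by apply: (IH _ _ j) => k.
Qed.

Section NestedIndependence.
Local Open Scope ring_scope.
Variables (R : realType) (n : nat).
Implicit Types (M : matroid 'I_n) (x : 'rV[R]_n) (B F G : {set 'I_n}).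

Section ChainMax.
Variables (FF : {set {set 'I_n}}) (c : {set 'I_n} -> R).
Hypothesis chFF : is_chain FF.
Hypothesis c_ge0 : forall F, 0 <= c F.

Definition chain_weight (i : 'I_n) : R := \sum_(F in FF | i \in F) c F.

Lemma lfun_chain_weight x :
  lfun chain_weight x = \sum_(F in FF) c F * sumOn x F.
Proof.
rewrite /lfun /chain_weight /sumOn.
under eq_bigr => i _ do rewrite mulr_suml.
rewrite (exchange_big_dep [in FF]) /=; last by move=> i F _ /andP[].
apply: eq_bigr => F FFF; rewrite mulr_sumr.
by apply: eq_bigl => i; rewrite FFF.
Qed.

(** By [chain_basis] a single basis maximizes the sums over all members of the chain
    simultaneously. *)
Lemma is_max_chain_weight M s : is_max (base_polytope M) chain_weight s =
  (s == \sum_(F in FF) c F * (rk M F)%:R).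
Proof.
have [B BM hB] := chain_basis M chFF.
have ub x : base_polytope M x ->
    lfun chain_weight x <= \sum_(F in FF) c F * (rk M F)%:R.
  apply: base_polytope_le => C CM; rewrite lfun_chain_weight.
  apply: ler_sum => F _; rewrite sumOn_char_vec ler_wpM2l //.
  by rewrite ler_nat rk_ge.
have att : lfun chain_weight (char_vec R B) = \sum_(F in FF) c F * (rk M F)%:R.
  rewrite lfun_chain_weight; apply: eq_bigr => F FFF.
  by rewrite sumOn_char_vec hB.
have PB := base_polytope_vertex R BM.
apply/andP/eqP => [[/asboolP[x Mx <-] /asboolP mx]|->].
  by apply/eqP; rewrite eq_le ub // -att mx.
by split; apply/asboolP => //; exists (char_vec R B).
Qed.

End ChainMax.

Lemma rank_relabel (s : 'S_n) M : rank (relabel s M) = rank M.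
Proof.
have [B BM] := exists_basis M.
have sBM : s @: B \in bases (relabel s M) by rewrite mem_relabel.
by rewrite (rank_basis BM) (rank_basis sBM) card_imset //; exact: perm_inj.
Qed.

Lemma card_bases_relabel (s : 'S_n) M : #|bases (relabel s M)| = #|bases M|.
Proof. by apply: card_imset; apply/imset_inj/perm_inj. Qed.

(** Ranks are at most [n], so with powers of [n.+1] the maximum of the form encodes the rank of each
    member of the chain as a digit. *)
Definition flat_weight F : R := (n.+1 ^ enum_rank F)%:R.

(** Equal maxima have equal digits, so [M'] gives each cyclic flat of [M] the same rank, and
    [basis_of_cyclic_flats] applies to the bases of [M']. *)
Lemma sub_of_max_cyclic_flats M M' : nested M -> rank M' = rank M ->
  is_max (base_polytope M') (chain_weight [set F | cyclic_flat M F]%SET flat_weight)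
    (\sum_(F in [set F | cyclic_flat M F]%SET) flat_weight F * (rk M F)%:R) ->
  bases M' \subset bases M.
Proof.
move=> nM rM; rewrite is_max_chain_weight; last 2 first.
- exact: nested_chain.
- by move=> F; exact: ler0n.
set FF := [set F | _ F]%SET => /eqP e.
pose a (M0 : matroid 'I_n) (i : 'I_#|{set 'I_n}|) :=
  if enum_val i \in FF then rk M0 (enum_val i) else 0%N.
have sumE M0 : \sum_(F in FF) flat_weight F * (rk M0 F)%:R =
    (\sum_(i < #|{set 'I_n}|) n.+1 ^ i * a M0 i)%N%:R :> R.
  rewrite natr_sum (reindex enum_rank) /=; last exact/onW_bij/enum_rank_bij.
  rewrite [LHS]big_mkcond; apply: eq_bigr => F _.
  by rewrite /a enum_rankK /flat_weight; case: ifP; rewrite ?muln0 // natrM.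
have aW M0 i : (a M0 i < n.+1)%N.
  rewrite /a; case: ifP => // _; rewrite ltnS.
  have [B _ ->] := rk_attained M0 (enum_val i).
  by rewrite -[leqRHS]card_ord max_card.
move: e; rewrite !sumE => /eqP; rewrite eqr_nat => /eqP e.
have rkE F : F \in FF -> rk M F = rk M' F.
  by move=> FFF; have := digits_inj (aW M) (aW M') e (enum_rank F); rewrite /a enum_rankK FFF.
apply/fintype.subsetP => B BM'; apply: basis_of_cyclic_flats.
  by rewrite -(rank_basis BM') rM.
by move=> F cF; rewrite rkE ?inE //; exact: rk_ge.
Qed.

Lemma nested_reps_independent r m (N : 'I_m -> matroid 'I_n) (d : 'I_m -> R) :
  nested_reps r N ->
  (forall x, \sum_j d j * sym_indic (base_polytope (N j)) x = 0) ->
  forall j, d j = 0.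
Proof.
move=> [nestN _ isoN] zN j1; apply/eqP/negPn/negP => dj1.
(* Among the nonzero coefficients, one whose matroid has the fewest bases: an inclusion of bases
   into it is then an equality. *)
have [j0 dj0 min0] :=
  @arg_minnP _ j1 (fun j => d j != 0) (fun j => #|bases (N j)|) dj1.
pose K (p : 'I_m * 'S_n) : set 'rV[R]_n := base_polytope (relabel p.2 (N p.1)).
pose FF := [set F | cyclic_flat (N j0) F]%SET.
have zmax : \sum_(p | is_max (K p) (chain_weight FF flat_weight)
    (\sum_(F in FF) flat_weight F * (rk (N j0) F)%:R)) d p.1 = 0.
  apply: euler_max => [p|p|x].
  - exact: base_polytope_compact.
  - exact: base_polytope_convex.
  - have := zN x; under eq_bigr => j _ do rewrite sym_indicE mulrCA.
    rewrite -mulr_sumr => /eqP; rewrite mulf_eq0 invr_eq0 pnatr_eq0.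
    rewrite gtn_eqF ?fact_gt0 //= => /eqP S0; rewrite -[RHS]S0.
    under [RHS]eq_bigr => j _ do rewrite /sym_count mulr_sumr.
    rewrite pair_big /= [LHS]big_mkcond; apply: eq_bigr => -[j s] _ /=.
    rewrite indicE /= [_ \in _](_ : _ = `[< K (j, s) x >]) //.
    by case: ifP; rewrite ?mulr1 ?mulr0.
have sub p : is_max (K p) (chain_weight FF flat_weight)
    (\sum_(F in FF) flat_weight F * (rk (N j0) F)%:R) ->
    d p.1 = if p.1 == j0 then d j0 else 0.
  case: p => j s mx /=; case: eqVneq => [->//|ne]; apply/eqP.
  apply: contraNT ne => dj; rewrite eq_sym; apply/eqP/isoN/isomorphic_sym.
  apply/isomorphic_relabel; exists s; apply: matroid_eq; apply/esym/eqP.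
  have [nj0 rj0] := nestN j0; have [nj rj] := nestN j.
  rewrite eqEcard card_bases_relabel (min0 j dj) andbT.
  have rE : rank (relabel s (N j)) = rank (N j0) by rewrite rank_relabel rj rj0.
  exact: (sub_of_max_cyclic_flats nj0 rE mx).
(* The sum is now a multiple of [d j0], and the multiple is nonzero because the identity relabeling
   of [N j0] contributes. *)
move/eqP: zmax; rewrite (eq_bigr _ sub) -big_mkcondr /= sumr_const.
rewrite mulrn_eq0 (negbTE dj0) orbF => /eqP/card0_eq/(_ (j0, 1%g))/negbT/negP; apply.
apply/andP; split=> //; rewrite [K _]/(base_polytope (relabel 1%g (N j0))) relabel1.
rewrite is_max_chain_weight //.
by apply: nested_chain; case: (nestN j0).
Qed.

End NestedIndependence.

(** * Direct sums of uniform matroids *)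

Section BlockMatroid.
Local Open Scope ring_scope.
Variables (R : realType) (n k : nat) (blk : 'I_n -> 'I_k) (rho : 'I_k -> nat).
Variable M : matroid 'I_n.
Implicit Types (x : 'rV[R]_n) (S : {set 'I_k}) (C : {set {set 'I_k}}) (B : {set 'I_n}).

Definition blocks S : {set 'I_n} := [set e | blk e \in S]%SET.
Definition block (i : 'I_k) : {set 'I_n} := [set e | blk e == i]%SET.

Hypothesis basesE : forall B, B \in bases M <-> forall i, #|block i :&: B| = rho i.

Lemma sumOn_blocks x S : sumOn x (blocks S) = \sum_(i in S) sumOn x (block i).
Proof.
rewrite /sumOn (partition_big blk [in S]) /= => [|e]; last by rewrite inE.
apply: eq_bigr => i iS; apply: eq_bigl => e; rewrite !inE.
by case: eqP => [->|]; rewrite ?iS ?andbF.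
Qed.

Lemma sumOn_all x : sumOn x [set: 'I_n]%SET = \sum_i sumOn x (block i).
Proof.
have -> : [set: 'I_n]%SET = blocks [set: 'I_k]%SET by apply/finset.setP => e; rewrite !inE.
by rewrite sumOn_blocks; apply: eq_bigl => i; rewrite inE.
Qed.

Lemma rk_blocks S : (rk M (blocks S))%:R = \sum_(i in S) (rho i)%:R :> R.
Proof.
have [B /basesE BM ->] := rk_attained M (blocks S).
rewrite -sumOn_char_vec sumOn_blocks; apply: eq_bigr => i _.
by rewrite sumOn_char_vec BM.
Qed.

Lemma rank_blocks : (rank M)%:R = \sum_i (rho i)%:R :> R.
Proof.
have [B BM] := exists_basis M.
rewrite (rank_basis BM) -[B]finset.setTI -sumOn_char_vec sumOn_all.
by apply: eq_bigr => i _; rewrite sumOn_char_vec (proj1 (basesE B)).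
Qed.

Lemma rk_block i : rk M (block i) = rho i.
Proof. by have [B /basesE BM ->] := rk_attained M (block i). Qed.

Lemma block_polytope x : base_polytope M x <->
  [/\ forall i, 0 <= x 0 i <= 1, sumOn x [set: 'I_n]%SET = (rank M)%:R &
      forall i, sumOn x (block i) = (rho i)%:R].
Proof.
have blkL i : block i \in [set block i | i : 'I_k]%SET by apply/imsetP; exists i.
rewrite (@base_polytope_laminar R n M [set block i | i : 'I_k]%SET (rk M) (rk M)).
- split=> -[x01 xT h]; split=> //.
    move=> i; have := h _ (blkL i).
    by rewrite rk_block -eq_le eq_sym => /eqP.
  by move=> _ /imsetP[i _ ->]; rewrite rk_block h lexx.
- move=> _ _ /imsetP[i _ ->] /imsetP[j _ ->].
  have [->|ij] := eqVneq i j; first by rewrite fintype.subxx.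
  apply/or3P; apply: Or33; rewrite -finset.setI_eq0.
  apply/eqP/finset.setP => e; rewrite !inE.
  by case: eqVneq => // ->; rewrite (negbTE ij).
- move=> B; split=> [BM|[_ h]].
    split; first by rewrite (rank_basis BM).
    by move=> _ /imsetP[i _ ->]; rewrite rk_block (proj1 (basesE B)) // leqnn.
  apply/basesE => i; have := h _ (blkL i).
  by rewrite rk_block -eqn_leq eq_sym => /eqP.
Qed.

(** Unions of blocks along [C] again form a chain; bounding them by their ranks in [M] gives a chain
    matroid, which has the bases of [M] among its own. *)
Lemma nested_of_chain C : is_chain C -> exists N : matroid 'I_n,
  [/\ nested N, rank N = rank M & forall x, base_polytope N x <->
     [/\ forall i, 0 <= x 0 i <= 1, sumOn x [set: 'I_n]%SET = (rank M)%:R &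
        forall S, S \in C -> sumOn x (blocks S) <= (rk M (blocks S))%:R]].
Proof.
move=> chC; pose FF := [set blocks S | S in C]%SET.
have chFF : is_chain FF.
  have mono S S' : S \subset S' -> blocks S \subset blocks S'.
    by move=> /fintype.subsetP h; apply/fintype.subsetP => e; rewrite !inE => /h.
  move=> _ _ /imsetP[S SC ->] /imsetP[S' S'C ->].
  by have /orP[/mono->|/mono->] := chC _ _ SC S'C; rewrite ?orbT.
have [B BM] := exists_basis M.
have BFF : B \in chain_bases FF (rk M) (rank M).
  by apply/chain_basesP; split=> [|F _]; [rewrite (rank_basis BM) | exact: rk_ge].
have n0 : chain_bases FF (rk M) (rank M) != finset.set0 by apply/finset.set0Pn; exists B.
pose N := chain_matroid chFF n0.
have rN : rank N = rank M by rewrite (@rank_basis _ N B BFF) (rank_basis BM).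
exists N; split=> [||x] //; first exact: chain_matroid_nested.
rewrite (@base_polytope_laminar R n N FF (fun=> 0%N) (rk M)) ?rN.
- split=> -[x01 xT h]; split=> //.
    by move=> S SC; have /andP[] := h _ (imset_f blocks SC).
  move=> _ /imsetP[S SC ->]; rewrite h // andbT.
  by apply: sumr_ge0 => i _; case/andP: (x01 i).
- by move=> F G FF1 GF; have /orP[->|->] := chFF F G FF1 GF; rewrite ?orbT.
- by move=> C'; split=> [/chain_basesP|h]; last exact/chain_basesP.
Qed.

(** Both sides vanish off the slice of the cube by the rank hyperplane. On it the excesses [y] sum
    to zero, [N C] covers [x] exactly when [C] is a chain of sets with nonpositive excess, and
    [alt_chains_nonpos] evaluates the sum. *)
Lemma block_indicator (N : {set {set 'I_k}} -> matroid 'I_n) x :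
  (forall C, is_chain C -> forall x, base_polytope (N C) x <->
     [/\ forall i, 0 <= x 0 i <= 1, sumOn x [set: 'I_n]%SET = (rank M)%:R &
        forall S, S \in C -> sumOn x (blocks S) <= (rk M (blocks S))%:R]) ->
  \1_(base_polytope M) x = (-1) ^+ k.-1 *
    \sum_(C in chains_in (proper_subsets [set: 'I_k]%SET))
      (-1) ^+ #|C| * \1_(base_polytope (N C)) x :> R.
Proof.
move=> hN.
have indE (P : set 'rV[R]_n) : \1_P x = (`[< P x >])%:R :> R by rewrite indicE.
under eq_bigr => C _ do rewrite indE; rewrite indE.
have [[x01 xT]|nbox] := pselect ((forall i, 0 <= x 0 i <= 1) /\
    sumOn x [set: 'I_n]%SET = (rank M)%:R); last first.
  rewrite asboolF => [|/block_polytope[x01 xT _]]; last exact: nbox.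
  rewrite big1 ?mulr0 // => C /chains_inP[_ chC].
  rewrite asboolF ?mulr0 // => /(hN C chC)[x01 xT _]; exact: nbox.
pose y i := sumOn x (block i) - (rho i)%:R.
have y0 : \sum_i y i = 0 by rewrite sumrB -sumOn_all xT rank_blocks subrr.
have -> : `[< base_polytope M x >] = [forall i, y i == 0].
  apply/asboolP/forallP => [/block_polytope[_ _ h] i|h]; first by rewrite /y h subrr.
  by apply/block_polytope; split=> // i; apply/eqP; rewrite -subr_eq0; exact: h.
pose A := [set S in proper_subsets [set: 'I_k] | \sum_(i in S) y i <= 0]%SET.
have -> : \sum_(C in chains_in (proper_subsets [set: 'I_k]%SET))
    (-1) ^+ #|C| * (`[< base_polytope (N C) x >])%:R = (alt_chains A)%:~R :> R.
  rewrite /alt_chains rmorph_sum [RHS]big_mkcond [LHS]big_mkcond /=.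
  apply: eq_bigr => C _; rewrite rmorphXn rmorphN1 /=.
  have [/chains_inP[CP chC]|nC] := boolP (C \in chains_in (proper_subsets _)); last first.
    rewrite ifN //; apply: contraNN nC => /chains_inP[CA chC].
    apply/chains_inP; split=> //; apply: fintype.subset_trans CA _.
    by apply/fintype.subsetP => S; rewrite inE => /andP[].
  have yS S : (sumOn x (blocks S) <= (rk M (blocks S))%:R) = (\sum_(i in S) y i <= 0).
    by rewrite sumrB -rk_blocks -sumOn_blocks subr_le0.
  have -> : `[< base_polytope (N C) x >] = (C \in chains_in A).
    apply/asboolP/chains_inP => [/(hN C chC)[_ _ h]|[CA _]].
      split=> //; apply/fintype.subsetP => S SC.
      by rewrite inE (fintype.subsetP CP) // -yS h.
    apply/(hN C chC); split=> // S /(fintype.subsetP CA).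
    by rewrite inE yS => /andP[].
  by case: ifP; rewrite ?mulr1 ?mulr0.
rewrite alt_chains_nonpos // card_ord; case: ifP => _; last by rewrite mulr0.
by rewrite rmorphXn rmorphN1 -exprMn mulrNN mulr1 expr1n.
Qed.

(** After symmetrization each nested matroid can be replaced by its representative, so the
    coefficient collects the signs of the chains in that class. *)
Lemma block_coef_vec m (N : 'I_m -> matroid 'I_n) :
  nested_reps (rank M) N -> exists c, coef_vec R N M c.
Proof.
move=> [_ exN isoN].
have /choice[N' N'P] C : exists N' : matroid 'I_n, is_chain C ->
    [/\ nested N', rank N' = rank M & forall x, base_polytope N' x <->
     [/\ forall i, 0 <= x 0 i <= 1, sumOn x [set: 'I_n]%SET = (rank M)%:R &
        forall S, S \in C -> sumOn x (blocks S) <= (rk M (blocks S))%:R]].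
  by have [/nested_of_chain[N' ?]|] := pselect (is_chain C); [exists N' | exists M].
pose chains := chains_in (proper_subsets [set: 'I_k]%SET).
exists (\row_j ((-1) ^+ k.-1 *
  \sum_(C in chains | `[< isomorphic (N' C) (N j) >]) (-1) ^+ #|C|)) => x.
under eq_bigr => j _ do rewrite sym_indicE mulrCA.
rewrite sym_indicE -mulr_sumr; congr (_ * _).
have -> : sym_count M x = (-1) ^+ k.-1 * \sum_(C in chains) (-1) ^+ #|C| * sym_count (N' C) x.
  under [in RHS]eq_bigr => C _ do rewrite mulr_sumr.
  rewrite exchange_big /= mulr_sumr; apply: eq_bigr => s _.
  have relE (M' : matroid 'I_n) : \1_(base_polytope (relabel s M')) x =
      \1_(base_polytope M') (col_perm s x) :> R.
    rewrite !indicE; congr (_%:R); congr nat_of_bool.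
    by apply/idP/idP; rewrite !inE => /base_polytope_relabel.
  rewrite relE (@block_indicator N') => [|C chC]; last by case: (N'P C chC).
  by congr (_ * _); apply: eq_bigr => C _; rewrite relE.
under [RHS]eq_bigr => j _ do rewrite mxE rmorphM rmorphXn rmorphN1 -mulrA.
rewrite -mulr_sumr; congr (_ * _).
under [RHS]eq_bigr => j _ do rewrite rmorph_sum mulr_suml.
rewrite (exchange_big_dep [in chains]) /=; last by move=> j C _ /andP[].
apply: eq_bigr => C Cch; rewrite rmorphXn rmorphN1.
have /chains_inP[_ chC] := Cch; have [nN' rN' _] := N'P C chC.
have [j0 isoj0] := exN _ nN' rN'.
rewrite (big_pred1 j0) => [|j].
  have /isomorphic_relabel[s ->] := isoj0; by rewrite sym_count_relabel.
rewrite /= Cch /=; apply/asboolP/eqP => [isoj|->//].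
exact/isoN/(isomorphic_trans (isomorphic_sym isoj)).
Qed.

End BlockMatroid.

Lemma perm_of_card (T : finType) (B B' : {set T}) : #|B| = #|B'| ->
  exists t : {perm T}, t @: B = B'.
Proof.
have [m] := ubnP #|B :\: B'|; elim: m B => // m IHm B; rewrite ltnS => leB cB.
have [BB'|] := boolP (B \subset B').
  exists 1%g; rewrite -[RHS](_ : B = B'); last by apply/eqP; rewrite eqEcard BB' cB leqnn.
  by rewrite -[RHS]finset.imset_id; apply: eq_imset => i; rewrite perm1.
case/subsetPn => x xB xB'.
have [y yB' yB] : exists2 y, y \in B' & y \notin B.
  apply/subsetPn; apply: contraNN xB' => B'B.
  suff -> : B' = B by [].
  by apply/eqP; rewrite eqEcard B'B cB leqnn.
have [||t tE] := IHm (y |: B :\ x).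
- exact: leq_trans (card_exchangeD xB xB' yB') leB.
- by rewrite card_exchange.
exists (tperm x y * t)%g; rewrite -tE.
have -> : (y |: B :\ x)%SET = tperm x y @: B.
  apply/finset.setP => z; rewrite -[z](tpermK x y) mem_imset; last exact: perm_inj.
  move: (tperm x y z) => {}z; rewrite !inE; case: tpermP => [->|->|/eqP zx /eqP zy].
  - by rewrite eqxx xB.
  - rewrite eqxx (negbTE yB) /= orbF; apply/negbTE.
    by apply: contraNneq yB => <-.
  - by rewrite (negbTE zx) (negbTE zy).
by rewrite -finset.imset_comp; apply: eq_imset => z; rewrite /= permM.
Qed.

(** * Generic points of a base polytope *)

Section SeparatingPoint.
Local Open Scope ring_scope.
Variables (R : realType) (n : nat).

Lemma nonroot_gt0 (p : {poly R}) : p != 0 -> exists2 t, 0 < t & ~~ root p t.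
Proof.
move=> p0; pose s : seq R := [seq i.+1%:R | i <- iota 0 (size p)].
have us : uniq s.
  rewrite map_inj_uniq ?iota_uniq // => i j /eqP.
  by rewrite eqr_nat => /eqP [].
have [all_r|] := boolP (all (root p) s).
  by have := max_poly_roots p0 all_r us; rewrite size_map size_iota ltnn.
by case/allPn => t /mapP[i _ ->] rt; exists i.+1%:R.
Qed.

(* The points with barycentric coordinates proportional to the powers of [t]
   lie on no given finite union of hyperplanes, for all but finitely many [t]. *)
Lemma separating_point (M : matroid 'I_n) (J : finType) (G : J -> {set 'I_n}) (c : J -> R) :
  (forall j, exists2 B, B \in bases M & #|G j :&: B|%:R != c j) ->
  exists2 y : 'rV[R]_n, base_polytope M y & forall j, sumOn y (G j) != c j.
Proof.
move=> h; pose rnk (B : {set 'I_n}) : nat := enum_rank B.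
(* Up to a positive factor, [(p j).[t]] is the defect of the [j]-th equation at the point with
   parameter [t]. Distinct exponents keep the defects at the vertices apart as coefficients. *)
pose p j : {poly R} := \sum_(B in bases M) (#|G j :&: B|%:R - c j) *: 'X^(rnk B).
have p0 j : p j != 0.
  have [B BM] := h j; rewrite -subr_eq0; apply: contraNneq => pj0.
  have <- : (p j)`_(rnk B) = #|G j :&: B|%:R - c j; last by rewrite pj0 coef0.
  rewrite /p coef_sum (bigD1 B) //= coefZ coefXn eqxx mulr1 big1 ?addr0 //.
  move=> B' /andP[_ B'B]; rewrite coefZ coefXn.
  case: eqP => [e|]; last by rewrite mulr0.
  by move: B'B; rewrite -(inj_eq enum_rank_inj) -val_eqE /= -[X in _ != X]/(rnk B) e eqxx.
have [t t0] : exists2 t, 0 < t & ~~ root (\prod_j p j) t.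
  by apply: nonroot_gt0; apply/prodf_neq0.
rewrite /root horner_prod => /prodf_neq0 pt.
pose Z := \sum_(B in bases M) t ^+ rnk B.
have Z0 : 0 < Z.
  have [B BM] := exists_basis M.
  rewrite /Z (bigD1 B) //= ltr_wpDr ?exprn_gt0 //.
  by apply: sumr_ge0 => B' _; rewrite exprn_ge0 // ltW.
exists (\sum_(B in bases M) (t ^+ rnk B / Z) *: char_vec R B).
  rewrite base_polytopeE; exists (fun B => t ^+ rnk B / Z); split=> //.
    by move=> B _; rewrite divr_ge0 ?exprn_ge0 // ltW.
  by rewrite -mulr_suml divff // gt_eqF.
move=> j; rewrite -subr_eq0; apply: contraNneq (pt j isT) => e; apply/eqP.
have -> : (p j).[t] =
    Z * (sumOn (\sum_(B in bases M) (t ^+ rnk B / Z) *: char_vec R B) (G j) - c j).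
  have Zc : Z * c j = \sum_(B in bases M) t ^+ rnk B * c j by rewrite mulr_suml.
  rewrite sumOnE lfun_comb mulrBr Zc mulr_sumr /p horner_sum -sumrB.
  apply: eq_bigr => B _; rewrite hornerZ hornerXn -sumOnE sumOn_char_vec.
  by rewrite mulrA [Z * _]mulrC divfK ?gt_eqF // -mulrBr mulrC.
by rewrite e mulr0.
Qed.

End SeparatingPoint.

(** * Extremality *)

Section Extremal.
Local Open Scope ring_scope.
Variables (R : realType) (n k : nat) (blk : 'I_n -> 'I_k) (rho : 'I_k -> nat).
Variable M : matroid 'I_n.
Hypothesis basesE : forall B : {set 'I_n},
  B \in bases M <-> forall i, #|block blk i :&: B| = rho i.
Implicit Types (M : matroid 'I_n) (x y : 'rV[R]_n).

Lemma sym_count_ge0 M' x : 0 <= sym_count M' x.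
Proof. by apply: sumr_ge0 => s _; rewrite indicE ler0n. Qed.

Lemma sym_count_le M' x : sym_count M' x <= n`!%:R.
Proof.
rewrite -card_Sn -sum1_card natr_sum; apply: ler_sum => s _.
by rewrite indicE ler_nat; case: (_ \in _).
Qed.

Lemma sym_count_ge1 M' x : base_polytope M' x -> 1 <= sym_count M' x.
Proof.
move=> Mx; rewrite /sym_count (bigD1 1%g) //= relabel1 indicE mem_set //.
by rewrite lerDl; apply: sumr_ge0 => s _; rewrite indicE ler0n.
Qed.

(** By [not_fits_point], this holds exactly when the relabelings of the polytope of [M] cover that
    of [M']. *)
Definition fits M' := [exists s : 'S_n, bases M' \subset bases (relabel s M)].

(** For every relabeling of [M] some basis of [M'] violates a block equation; a generic point of the
    polytope violates all the chosen equations at once. *)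
Lemma not_fits_point M' : ~~ fits M' ->
  exists2 y : 'rV[R]_n, base_polytope M' y & sym_count M y = 0.
Proof.
move/existsPn => nfit.
have /choice[i iP] (s : 'S_n) : exists i, exists2 B, B \in bases M' &
    #|(s @: block blk i) :&: B|%:R != (rho i)%:R :> R.
  have /subsetPn[B BM' nB] := nfit s.
  have [C BE] : exists C : {set 'I_n}, B = s @: C.
    exists (s^-1%g @: B); rewrite -finset.imset_comp -[LHS]finset.imset_id.
    by apply: eq_imset => z; rewrite /= permKV.
  have nC : C \notin bases M by move: nB; rewrite BE mem_relabel.
  have /existsP[i] : [exists i, #|block blk i :&: C| != rho i].
    apply: contraNT nC => /existsPn hC; apply/basesE => i; apply/eqP.
    by have := hC i; rewrite negbK.
  move=> iC; exists i; exists B => //; rewrite BE eqr_nat -imsetI; last first.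
    by move=> ? ? _ _; exact: perm_inj.
  by rewrite card_imset //; exact: perm_inj.
have [y M'y yP] := separating_point iP.
exists y => //; apply: big1 => s _; rewrite indicE.
have [|//] := boolP (y \in _); rewrite inE => /base_polytope_relabel/(block_polytope basesE)[_ _ h].
have := yP s; rewrite -h => /eqP[].
rewrite sumOnE [RHS]sumOnE lfun_col_perm /lfun; apply: eq_bigr => e _ /=.
congr (_%:R * _); congr nat_of_bool.
by rewrite -{1}[e](permKV s) mem_imset //; exact: perm_inj.
Qed.

Variable B0 : {set 'I_n}.
Hypothesis B0M : B0 \in bases M.

Lemma sym_count_char_vec M' :
  sym_count M' (char_vec R B0) = \sum_(s : 'S_n) (B0 \in bases (relabel s M'))%:R.
Proof.
apply: eq_bigr => s _; rewrite indicE; congr (_%:R); congr nat_of_bool.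
by apply/idP/idP; rewrite inE => /base_polytope_char_vec.
Qed.

(** At a vertex, [sym_count] counts the permutations that make [B0] a basis. Every basis of
    [relabel s M] is carried to [B0] by some permutation, so equal counts force equal sets of
    bases. *)
Lemma sym_count_fits M' (s : 'S_n) : bases M' \subset bases (relabel s M) ->
  sym_count M' (char_vec R B0) <= sym_count M (char_vec R B0) /\
  (sym_count M' (char_vec R B0) = sym_count M (char_vec R B0) -> M' = relabel s M).
Proof.
move=> sub; rewrite -(sym_count_relabel s M) !sym_count_char_vec.
have le t : (B0 \in bases (relabel t M'))%:R <=
    (B0 \in bases (relabel t (relabel s M)))%:R :> R.
  rewrite ler_nat; case: (boolP (B0 \in bases (relabel t M'))) => //.
  case/imsetP => C CM' ->; rewrite mem_relabel.
  by rewrite (fintype.subsetP sub).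
split=> [|/esym/eqP e]; first by apply: ler_sum => t _.
apply: matroid_eq; apply/eqP; rewrite finset.eqEsubset sub /=.
apply/fintype.subsetP => B BM; have {}BM : B \in bases (relabel s M) by [].
have cB : #|B| = #|B0| by rewrite -(rank_basis B0M) -(rank_basis BM) rank_relabel.
have [t tB] := perm_of_card cB.
move: e; rewrite -subr_eq0 -sumrB psumr_eq0 => [|i _]; last by rewrite subr_ge0.
move/allP/(_ t); rewrite mem_index_enum => /(_ isT).
rewrite -[implb _ _]/(_ == _) -tB !mem_relabel BM.
by case: (B \in bases M') => //; rewrite subr0 oner_eq0.
Qed.

Lemma vertex_functional : exists f : matroid 'I_n -> R,
  [/\ forall m (N : 'I_m -> matroid 'I_n) M' c, coef_vec R N M' c ->
        f M' = \sum_j (c 0 j)%:~R * f (N j),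
      forall M', f M' <= f M
    & forall M', f M' = f M -> exists s : 'S_n, M' = relabel s M].
Proof.
have /choice[y yP] M' : exists y : 'rV[R]_n, ~~ fits M' -> base_polytope M' y /\ sym_count M y = 0.
  have [_|/not_fits_point[y M'y yM]] := boolP (fits M'); first by exists 0.
  by exists y.
(* A count is at most [n!], and it is at least 1 at the point chosen for [M'] itself. Hence [f] is
   at most 0 on matroids that do not fit, while [f M] is at least 1. *)
pose f M' := sym_count M' (char_vec R B0) -
  n`!%:R * \sum_(M'' | ~~ fits M'') sym_count M' (y M'').
have fM : f M = sym_count M (char_vec R B0).
  by rewrite /f big1 ?mulr0 ?subr0 // => M'' /yP[].
have f_le M' : f M' <= sym_count M' (char_vec R B0).
  rewrite gerBl mulr_ge0 ?ler0n //.
  by apply: sumr_ge0 => M'' _; exact: sym_count_ge0.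
have f_not_fits M' : ~~ fits M' -> f M' < f M.
  move=> nf; have [M'y _] := yP M' nf.
  apply: (@le_lt_trans _ _ 0); last first.
    by rewrite fM (lt_le_trans ltr01) // sym_count_ge1 //; exact: base_polytope_vertex.
  rewrite subr_le0 (le_trans (sym_count_le _ _)) //.
  rewrite -[leLHS]mulr1 ler_wpM2l ?ler0n // (le_trans (sym_count_ge1 M'y)) //.
  rewrite (bigD1 M') //= lerDl; apply: sumr_ge0 => M'' _; exact: sym_count_ge0.
exists f; split=> [m N M' c hc|M'|M' e].
- have lin x : sym_count M' x = \sum_j (c 0 j)%:~R * sym_count (N j) x.
    have := hc x; rewrite sym_indicE.
    under eq_bigr => j _ do rewrite sym_indicE mulrCA.
    by rewrite -mulr_sumr => /mulfI; apply; rewrite invr_eq0 pnatr_eq0 gtn_eqF ?fact_gt0.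
  rewrite /f lin; under [X in _ - _ * X]eq_bigr => M'' _ do rewrite lin.
  rewrite exchange_big /= mulr_sumr -sumrB; apply: eq_bigr => j _.
  by rewrite -mulr_sumr; ring.
- have [/existsP[s sub]|/f_not_fits/ltW//] := boolP (fits M').
  by rewrite (le_trans (f_le M')) // fM; have [] := sym_count_fits sub.
- have [/existsP[s sub]|/f_not_fits] := boolP (fits M'); last by rewrite e ltxx.
  have [le eqM] := sym_count_fits sub; exists s; apply: eqM.
  by apply/eqP; rewrite eq_le le -fM -e f_le.
Qed.

(** The values of [f] on the representatives define the linear functional. If a convex combination
    attains [f M], so does every point of nonzero weight; it then comes from a relabeling of [M],
    and independence identifies its coefficients with [c]. *)
Lemma block_matroid_extremal m (N : 'I_m -> matroid 'I_n) :
  nested_reps (rank M) N -> extremal R N M.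
Proof.
move=> hN; have [c hc] := block_coef_vec R basesE hN.
have [f [flin fle feq]] := vertex_functional.
exists c => //; split; first by apply: conv_hull_pt; exists M, c.
exists (fun j => f (N j)) => _ [p [w [v [w0 w1 vM ->]]]] neq.
have dotE M' c' : coef_vec R N M' c' ->
    \sum_j f (N j) * (map_mx intr c' : 'rV[R]_m) 0 j = f M'.
  by move=> /flin->; apply: eq_bigr => j _; rewrite mxE mulrC.
have dot_le i : lfun (fun j => f (N j)) (v i) <= f M.
  by have [M' [c' [_ hc' ->]]] := vM i; rewrite /lfun (dotE _ _ hc').
have dot_eq i : lfun (fun j => f (N j)) (v i) = f M -> v i = map_mx intr c.
  have [M' [c' [_ hc' ->]]] := vM i; rewrite /lfun (dotE _ _ hc') => /feq[s M'E].
  congr map_mx; apply/rowP => j; apply/eqP; rewrite -(eqr_int R) -subr_eq0; apply/eqP.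
  move: j; apply: (nested_reps_independent (d := fun j => (c' 0 j)%:~R - (c 0 j)%:~R) hN) => x.
  under eq_bigr => j _ do rewrite mulrBl.
  by rewrite sumrB -hc -hc' M'E !sym_indicE sym_count_relabel subrr.
rewrite (dotE _ _ hc) -[ltLHS]/(lfun _ _) lfun_comb lt_neqAle; apply/andP; split; last first.
  rewrite -[leRHS]mul1r -w1 mulr_suml; apply: ler_sum => i _.
  by rewrite ler_wpM2l.
apply/eqP => e; apply: neq.
have /psumr_eq0P z : forall i, true -> 0 <= w i * (f M - lfun (fun j => f (N j)) (v i)).
  by move=> i _; rewrite mulr_ge0 // subr_ge0.
have S0 : \sum_i w i * (f M - lfun (fun j => f (N j)) (v i)) = 0.
  by under eq_bigr do rewrite mulrBr; rewrite sumrB e -mulr_suml w1 mul1r subrr.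
transitivity (\sum_i w i *: (map_mx intr c : 'rV[R]_m)).
  apply: eq_bigr => i _; have /eqP := z S0 i isT; rewrite mulf_eq0 subr_eq0.
  by case/orP=> /eqP => [->|/esym/dot_eq->//]; rewrite !scale0r.
by rewrite -scaler_suml w1 scale1r.
Qed.

End Extremal.

(** Carries the direct sum over to [T], where the summands become the fibres of [tag (f e)]. *)
Lemma dsum_uniform_blocks (k : nat) (r n : 'I_k -> nat) (le_rn : forall i, (r i <= n i)%N)
    (T : finType) (f : T -> {i : 'I_k & 'I_(n i)}) (B : {set T}) : injective f ->
  f @: B \in bases (dsum (fun i => uniform (le_rn i))) <->
  forall i, #|[set e | tag (f e) == i] :&: B| = r i.
Proof.
move=> injf.
have cardE i : #|part (f @: B) i| = #|[set e | tag (f e) == i] :&: B|.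
  have injT : injective (Tagged (fun i => 'I_(n i)) : 'I_(n i) -> _).
    by move=> a b /eqP; rewrite eq_Tagged => /eqP.
  rewrite -(card_imset _ injT) -[RHS](card_imset _ injf); apply: eq_card => u.
  apply/imsetP/imsetP => [[a]|[e]]; rewrite !inE.
    by case/imsetP=> e eB ae ->; exists e => //; rewrite !inE -ae eqxx.
  case/andP=> /eqP ei eB ->; case fe: (f e) ei => [j a] /= ji.
  by rewrite -ji; exists a => //; rewrite inE; apply/imsetP; exists e.
rewrite inE; split=> [/forallP h i|h].
  by have := h i; rewrite inE cardE => /eqP.
by apply/forallP => i; rewrite inE cardE h.
Qed.

Theorem theorem8p1 (R : realType) (k : nat) (r n : 'I_k -> nat)
    (le_rn : forall i, (r i <= n i)%N)
    (M : matroid 'I_(\sum_(i < k) n i))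
    (hM : isomorphic M (dsum (fun i => uniform (le_rn i))))
    (m : nat) (N : 'I_m -> matroid 'I_(\sum_(i < k) n i))
    (hN : nested_reps (rank M) N) :
  extremal R N M.
Proof.
have [f [/bij_inj injf fM]] := hM; have [B0 B0M] := exists_basis M.
apply: (@block_matroid_extremal R _ _ (fun e => tag (f e)) r M _ B0) => // B.
rewrite fM; exact: dsum_uniform_blocks.
Qed.
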